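(* Let $R_{\mathrm{Bc}}=\mathbb Z\left[\frac12,a_1,a_2,a_3\right]$, graded by $\deg a_i=-4i$ ($i=1,2,3$), let $Q(t)=1-a_1t^2+a_2t^4-a_3t^6$, and let $$F_{\mathrm{Bc}}(u,v)=\left[\left(\frac{u\sqrt{Q(v)}-v\sqrt{Q(u)}}{u^2-v^2}\right)^2+a_3u^2v^2\right]^{-1/2}$$ (branch with leading term $u+v$). Then $F_{\mathrm{Bc}}$ is a formal group law over $R_{\mathrm{Bc}}$ and corresponds to a Hirzebruch genus, i.e. to a graded ring homomorphism $$\mathrm{Bc}:\Omega_{\mathrm U}\to R_{\mathrm{Bc}}$$ carrying the universal formal group law of complex cobordism to $F_{\mathrm{Bc}}$ (called the Buchstaber genus).
   Context: $\Omega_{\mathrm U}$ is the complex cobordism ring, graded with $\Omega_{\mathrm U}^{-2n}$ the cobordism classes of stably complex manifolds of real dimension $2n$; with its formal group law $F_{\mathrm U}$ it is identified with the Lazard ring (Quillen's theorem), so ring homomorphisms $\Omega_{\mathrm U}\to R$ (Hirzebruch genera) correspond bijectively to one-dimensional commutative formal group laws over $R$. The square root $\sqrt{Q(t)}$ is the power series with constant term $1$. With $H(u,v)=\frac{u\sqrt{Q(v)}-v\sqrt{Q(u)}}{u-v}$, the chosen branch is $F_{\mathrm{Bc}}(u,v)=\frac{u+v}{\sqrt{H(u,v)^2+a_3u^2v^2(u+v)^2}}$. *)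

(* Defs.v *)
From HB Require Import structures.
From mathcomp Require Import all_boot all_order all_algebra finmap.
From mathcomp Require Import generic_quotient ring_quotient.
From mathcomp Require Import boolp classical_sets.
From mathcomp.multinomials Require Import (canonicals, coercions) monalg.
From mathcomp.multinomials Require Import mpoly.

Set Implicit Arguments.
Unset Strict Implicit.
Unset Printing Implicit Defensive.

Import GRing.Theory.

Local Open Scope ring_scope.

(* Formal power series in n commuting variables over R.  The coefficients are
   wrapped in a record so that the ring structure below (Cauchy product) does
   not compete with pointwise structures on function types. *)
Record fps (n : nat) (R : Type) := Fps { fps_coef :> 'X_{1..n} -> R }.

HB.instance Definition _ n R := gen_eqMixin (fps n R).
HB.instance Definition _ n R := gen_choiceMixin (fps n R).

Lemma fpsP n R (f g : fps n R) : (forall m, f m = g m) -> f = g.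
Proof. by case: f g => [f] [g] /= /funext ->. Qed.

Section FpsRing.
Variables (n : nat) (R : comNzRingType).
Implicit Types (f g h : fps n R) (m : 'X_{1..n}).

Definition fps_const (c : R) : fps n R := Fps (fun m => c *+ (m == 0%MM)).
Definition fps_var (i : 'I_n) : fps n R := Fps (fun m => (m == U_(i)%MM)%:R).

Definition fps_add f g : fps n R := Fps (fun m => f m + g m).
Definition fps_opp f : fps n R := Fps (fun m => - f m).
Definition fps_mul f g : fps n R := Fps (fun m =>
  \sum_(k : 'X_{1..n < (mdeg m).+1, (mdeg m).+1} | m == (k.1 + k.2)%MM)
    f k.1 * g k.2).

Definition fps_trunc d f : {mpoly R[n]} :=
  \sum_(m : 'X_{1..n < d}) f m *: 'X_[m].

Lemma mcoeff_trunc d f m : (mdeg m < d)%N -> (fps_trunc d f)@_m = f m.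
Proof. exact: mcoeff_mpoly. Qed.

Lemma fps_mulE (p q : {mpoly R[n]}) f g m :
  (forall k, (mdeg k <= mdeg m)%N -> f k = p@_k) ->
  (forall k, (mdeg k <= mdeg m)%N -> g k = q@_k) ->
  fps_mul f g m = (p * q)@_m.
Proof.
move=> fp gq; rewrite mcoeffM /=; apply: eq_bigr => -[k l] _ /=.
by rewrite fp ?gq // -ltnS bmdeg.
Qed.

Fact fps_addA : associative fps_add.
Proof. by move=> f g h; apply: fpsP => m /=; rewrite addrA. Qed.
Fact fps_addC : commutative fps_add.
Proof. by move=> f g; apply: fpsP => m /=; rewrite addrC. Qed.
Fact fps_add0 : left_id (fps_const 0) fps_add.
Proof. by move=> f; apply: fpsP => m /=; rewrite mul0rn add0r. Qed.
Fact fps_addN : left_inverse (fps_const 0) fps_opp fps_add.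
Proof. by move=> f; apply: fpsP => m /=; rewrite mul0rn addNr. Qed.

HB.instance Definition _ := GRing.isZmodule.Build (fps n R)
  fps_addA fps_addC fps_add0 fps_addN.

Fact fps_mulA : associative fps_mul.
Proof.
move=> f g h; apply: fpsP => m; pose T := fps_trunc (mdeg m).+1.
rewrite (@fps_mulE (T f) (T g * T h)) ?(@fps_mulE (T f * T g) (T h)) ?mulrA //.
- by move=> k km; rewrite (@fps_mulE (T f) (T g)) // => l lk;
    rewrite mcoeff_trunc // ltnS (leq_trans lk).
- by move=> k km; rewrite mcoeff_trunc.
- by move=> k km; rewrite mcoeff_trunc.
- by move=> k km; rewrite (@fps_mulE (T g) (T h)) // => l lk;
    rewrite mcoeff_trunc // ltnS (leq_trans lk).
Qed.

Fact fps_mulC : commutative fps_mul.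
Proof.
move=> f g; apply: fpsP => m; pose T := fps_trunc (mdeg m).+1.
by rewrite (@fps_mulE (T f) (T g)) ?(@fps_mulE (T g) (T f)) 1?mulrC // => k km;
  rewrite mcoeff_trunc.
Qed.

Fact fps_mul1 : left_id (fps_const 1) fps_mul.
Proof.
move=> f; apply: fpsP => m; pose T := fps_trunc (mdeg m).+1.
rewrite (@fps_mulE 1 (T f)) ?mul1r ?mcoeff_trunc // => k km.
  by rewrite mcoeff1.
by rewrite mcoeff_trunc.
Qed.

Fact fps_mulDl : left_distributive fps_mul fps_add.
Proof.
move=> f g h; apply: fpsP => m /=; rewrite -big_split /=.
by apply: eq_bigr => k _; rewrite mulrDl.
Qed.

Fact fps_oner_neq0 : fps_const 1 != 0.
Proof.
apply/eqP => /(congr1 (fun f : fps n R => f 0%MM)) /= /eqP.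
by rewrite eqxx mul0rn (negbTE (oner_neq0 _)).
Qed.

HB.instance Definition _ := GRing.Zmodule_isComNzRing.Build (fps n R)
  fps_mulA fps_mulC fps_mul1 fps_mulDl fps_oner_neq0.

Definition fps_unit : {pred fps n R} := fun f => `[< exists g : fps n R, g * f = 1 >].
Definition fps_inv f : fps n R := xget f [set g : fps n R | g * f = 1].

Fact fps_mulV : {in fps_unit, left_inverse 1 fps_inv *%R}.
Proof. by move=> f /asboolP fU; apply: (@xgetPex _ f [set g : fps n R | g * f = 1]). Qed.
Fact fps_unitPl f g : g * f = 1 -> fps_unit f.
Proof. by move=> gf; apply/asboolP; exists g. Qed.
Fact fps_inv_out : {in [predC fps_unit], fps_inv =1 id}.
Proof.
move=> f; rewrite inE => /asboolP fNU; rewrite /fps_inv.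
by case: xgetP => // g _ gf; case: fNU; exists g.
Qed.

HB.instance Definition _ := GRing.ComNzRing_hasMulInverse.Build (fps n R)
  fps_mulV fps_unitPl fps_inv_out.

(* The square root with constant term 1: it is unique, and exists if f has
   constant term 1, as soon as 2 is invertible in R. *)
Definition fps_sqrt f : fps n R :=
  xget 0 [set g : fps n R | g 0%MM = 1 /\ g ^+ 2 = f].

End FpsRing.

Arguments fps_const {n R} c.
Arguments fps_var {n R} i.

(* F(g_1, .., g_n).  Only meaningful when the g_i have zero constant term: then
   the monomials of F of degree > mdeg m do not contribute to the coefficient
   at m, so the infinite sum over the monomials of F may be truncated. *)
Definition fps_subst n k (R : comNzRingType) (F : fps n R)
    (g : n.-tuple (fps k R)) : fps k R :=
  Fps (fun m => \sum_(a : 'X_{1..n < (mdeg m).+1})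
    F a * (\prod_(i < n) tnth g i ^+ a i) m).

Definition fps_map n (R S : Type) (phi : R -> S) (f : fps n R) : fps n S :=
  Fps (fun m => phi (f m)).

Definition fps1 k (R : comNzRingType) (f : fps 1 R) (g : fps k R) : fps k R :=
  fps_subst f [tuple g].
Definition fps2 k (R : comNzRingType) (F : fps 2 R) (g h : fps k R) : fps k R :=
  fps_subst F [tuple g; h].

Definition var n (R : comNzRingType) (i : nat) : fps n.+1 R :=
  fps_var (inord i).

(* One-dimensional commutative formal group laws; F has no constant term by the
   unit axiom, so that the inner substitutions are meaningful. *)
Definition is_fgl (R : comNzRingType) (F : fps 2 R) : Prop :=
  [/\ fps2 F (var 0 R 0) 0 = var 0 R 0,
      fps2 F 0 (var 0 R 0) = var 0 R 0,
      fps2 F (var 1 R 1) (var 1 R 0) = F &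
      let x := var 2 R 0 in let y := var 2 R 1 in let z := var 2 R 2 in
      fps2 F (fps2 F x y) z = fps2 F x (fps2 F y z)].

Section FpsMap.
Variables (R S : comNzRingType) (phi : {rmorphism R -> S}).

Lemma fps_map_const n c : fps_map phi (fps_const c : fps n R) = fps_const (phi c).
Proof. by apply: fpsP => m /=; rewrite raddfMn. Qed.

Lemma fps_map_var n (i : 'I_n) : fps_map phi (fps_var i) = fps_var i.
Proof. by apply: fpsP => m /=; rewrite rmorph_nat. Qed.

Lemma fps_mapD n (f g : fps n R) :
  fps_map phi (f + g) = fps_map phi f + fps_map phi g.
Proof. by apply: fpsP => m /=; rewrite rmorphD. Qed.

Lemma fps_mapM n (f g : fps n R) :
  fps_map phi (f * g) = fps_map phi f * fps_map phi g.
Proof.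
apply: fpsP => m /=; rewrite rmorph_sum /=.
by apply: eq_bigr => k _; rewrite rmorphM.
Qed.

Lemma fps_mapX n (f : fps n R) e : fps_map phi (f ^+ e) = fps_map phi f ^+ e.
Proof.
elim: e => [|e IHe]; last by rewrite !exprS fps_mapM IHe.
by rewrite !expr0 [LHS]fps_map_const rmorph1.
Qed.

Lemma fps_map_subst n k (F : fps n R) (g : n.-tuple (fps k R)) :
  fps_map phi (fps_subst F g) =
  fps_subst (fps_map phi F) (map_tuple (fps_map phi) g).
Proof.
apply: fpsP => m /=; rewrite rmorph_sum /=; apply: eq_bigr => a _.
rewrite rmorphM /=; congr (_ * _).
rewrite -[phi _]/(fps_map phi (\prod_(i < n) tnth g i ^+ a i) m).
congr (fps_coef _ m).
rewrite (big_morph (fps_map phi) (@fps_mapM k) (id1 := 1)); last first.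
  by rewrite [LHS]fps_map_const rmorph1.
by apply: eq_bigr => i _; rewrite fps_mapX tnth_map.
Qed.

Lemma fps_map2 k (F : fps 2 R) (g h : fps k R) :
  fps_map phi (fps2 F g h) =
  fps2 (fps_map phi F) (fps_map phi g) (fps_map phi h).
Proof.
rewrite fps_map_subst; congr fps_subst; exact: val_inj.
Qed.

End FpsMap.

Lemma fps2_add (R : comNzRingType) k (g h : fps k R) :
  g 0%MM = 0 -> h 0%MM = 0 -> fps2 (var 1 R 0 + var 1 R 1) g h = g + h.
Proof.
move=> g0 h0; apply: fpsP => m /=.
have [m0|m_neq0] := eqVneq m 0%MM.
  rewrite m0 g0 h0 addr0 big1 // => -[a /= ha] _.
  have -> : a = 0%MM.
    by apply/eqP; rewrite -mdeg_eq0 -leqn0 -ltnS; move: ha; rewrite mdeg0.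
  by rewrite ![0%MM == _]eq_sym !mnm1_eq0 addr0 mul0r.
have i01 : (inord 1 == inord 0 :> 'I_2) = false.
  by apply/eqP => /(congr1 val); rewrite /= !inordK.
have U_lt i : (mdeg (U_(i) : 'X_{1..2})%MM < (mdeg m).+1)%N.
  by rewrite mdeg1 ltnS lt0n mdeg_eq0.
have UU (i j : 'I_2) : (U_(i)%MM == U_(j)%MM :> 'X_{1..2}) = (i == j).
  by apply/eqP/eqP => [/mnmP/(_ i)|-> //]; rewrite !mnm1E eqxx; case: eqP.
have prodU (t : 2.-tuple (fps k R)) (i : 'I_2) :
    \prod_(j < 2) tnth t j ^+ (U_(i)%MM : 'X_{1..2}) j = tnth t i.
  rewrite (bigD1 i) //= mnm1E eqxx expr1 big1 ?mulr1 // => j ij.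
  by rewrite mnm1E eq_sym (negbTE ij).
rewrite (bigD1 (BMultinom (U_lt (inord 0)))) //=.
rewrite (bigD1 (BMultinom (U_lt (inord 1)))) //=; last first.
  by rewrite bmeqP /= UU i01.
rewrite [X in _ + (_ + X)]big1 ?addr0; last first.
  move=> a /andP[]; rewrite !bmeqP /= => /negbTE -> /negbTE ->.
  by rewrite addr0 mul0r.
rewrite !UU !(eqxx (inord _)) [inord 0 == _]eq_sym i01.
rewrite addr0 add0r !mul1r !prodU.
by rewrite !(tnth_nth 0) /= !inordK.
Qed.

Section MapToAdditive.
Variables (R S : comNzRingType) (phi : {rmorphism R -> S}) (F : fps 2 R).
Hypothesis phiF : fps_map phi F = var 1 S 0 + var 1 S 1.

Let var0 n i : fps_map phi (var n R i) 0%MM = 0.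
Proof. by rewrite fps_map_var /= eq_sym mnm1_eq0. Qed.

Let map2 n (g h : fps n.+1 R) :
  fps_map phi g 0%MM = 0 -> fps_map phi h 0%MM = 0 ->
  fps_map phi (fps2 F g h) = fps_map phi g + fps_map phi h.
Proof. by move=> g0 h0; rewrite fps_map2 phiF fps2_add. Qed.

Let mapB n (f g : fps n R) :
  fps_map phi (f - g) = fps_map phi f - fps_map phi g.
Proof. by apply: fpsP => m /=; rewrite rmorphB. Qed.

Lemma fps_map_comm_defect :
  fps_map phi (fps2 F (var 1 R 1) (var 1 R 0) - F) = 0.
Proof. by rewrite mapB map2 ?var0 // phiF !fps_map_var [X in X - _]addrC subrr. Qed.

Lemma fps_map_assoc_defect n (x := var n R 0) (y := var n R 1) (z := var n R 2) :
  fps_map phi (fps2 F (fps2 F x y) z - fps2 F x (fps2 F y z)) = 0.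
Proof.
rewrite {}/x {}/y {}/z.
have xy := map2 (var0 n 0) (var0 n 1); have yz := map2 (var0 n 1) (var0 n 2).
have add0 (f g : fps n.+1 S) : f 0%MM = 0 -> g 0%MM = 0 -> (f + g) 0%MM = 0.
  by move=> /= -> ->; rewrite addr0.
rewrite mapB !map2 ?xy ?yz ?addrA ?subrr ?var0 //.
all: by rewrite add0 ?var0.
Qed.

End MapToAdditive.

Definition dyadic_pred : {pred rat} :=
  fun q => `[< exists k : nat, 2 ^+ k * q \is a Num.int >].

Fact dyadic_subring_closed : subring_closed dyadic_pred.
Proof.
split=> [|x y /asboolP[k kx] /asboolP[l ly]|x y /asboolP[k kx] /asboolP[l ly]].
- by apply/asboolP; exists 0; rewrite mulr1.
- apply/asboolP; exists (k + l)%N.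
  rewrite exprD mulrBr [X in X * x]mulrC -!mulrA.
  by rewrite rpredB // rpredM // rpredX.
- apply/asboolP; exists (k + l)%N.
  by rewrite exprD mulrACA rpredM.
Qed.

HB.instance Definition _ :=
  GRing.isSubringClosed.Build rat dyadic_pred dyadic_subring_closed.

(* Z[1/2], as a subring of the rationals *)
Record dyadic := Dyadic { dyadic_val :> rat; _ : dyadic_val \in dyadic_pred }.

HB.instance Definition _ := [isSub for dyadic_val].
HB.instance Definition _ := [Choice of dyadic by <:].
HB.instance Definition _ := [SubChoice_isSubComNzRing of dyadic by <:].

Definition R_Bc := {mpoly dyadic[3]}.
HB.instance Definition _ := GRing.ComNzRing.on R_Bc.

Definition a1 : R_Bc := 'X_(inord 0).
Definition a2 : R_Bc := 'X_(inord 1).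
Definition a3 : R_Bc := 'X_(inord 2).

(* Homogeneous elements of degree d, where deg a_i = -4i; mnmwgt gives the
   variable of index i - 1 the weight i. *)
Definition R_Bc_homog (d : int) (x : R_Bc) : Prop :=
  forall m, m \in msupp x -> d = - (4 * mnmwgt m)%N%:Z.

Definition Q_Bc : fps 1 R_Bc :=
  let t := var 0 R_Bc 0 in
  1 - fps_const a1 * t ^+ 2 + fps_const a2 * t ^+ 4 - fps_const a3 * t ^+ 6.

Local Notation u := (var 1 R_Bc 0).
Local Notation v := (var 1 R_Bc 1).
Local Notation sqrtQ := (fps1 (fps_sqrt Q_Bc)).

(* The quotient (u sqrt(Q(v)) - v sqrt(Q(u))) / (u - v); the division is exact
   and u - v is not a zero divisor. *)
Definition H_Bc : fps 2 R_Bc :=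
  xget 0 [set h : fps 2 R_Bc | (u - v) * h = u * sqrtQ v - v * sqrtQ u].

Definition F_Bc : fps 2 R_Bc :=
  (u + v) / fps_sqrt (H_Bc ^+ 2 +
                      fps_const a3 * u ^+ 2 * v ^+ 2 * (u + v) ^+ 2).

Definition gen_ideal (R : comNzRingType) (G : R -> Prop) : {pred R} := fun p =>
  `[< exists s : seq (R * R),
        (forall c, c \in s -> G c.2) /\ p = \sum_(c <- s) c.1 * c.2 >].

Lemma gen_ideal_closed (R S : comNzRingType) (G : R -> Prop)
    (phi : {rmorphism R -> S}) :
  (forall r, G r -> phi r = 0) -> idealr_closed (gen_ideal G).
Proof.
move=> phiG; split.
- by apply/asboolP; exists [::]; rewrite big_nil.
- apply/asboolP => -[s [sG /(congr1 phi)/eqP]].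
  rewrite rmorph1 rmorph_sum big_seq big1 ?oner_eq0 // => c /sG cG.
  by rewrite rmorphM (phiG _ cG) mulr0.
- move=> a p q /asboolP[s [sG ->]] /asboolP[t [tG ->]].
  apply/asboolP; exists ([seq (a * c.1, c.2) | c <- s] ++ t); split.
    move=> c; rewrite mem_cat => /orP[/mapP[d ds ->]|]; last exact: tG.
    exact: sG ds.
  rewrite big_cat big_map mulr_sumr /=; congr (_ + _).
  by apply: eq_bigr => c _; rewrite mulrA.
Qed.

(* The complex cobordism ring with its formal group law, presented as the
   Lazard ring (Quillen): the quotient of Z[c_ij | i, j >= 1] by the relations
   making u + v + sum c_ij u^i v^j a commutative formal group law. *)

(* Indices are shifted by one: (i, j) stands for the generator c_(i+1, j+1). *)
Definition lazard_index := (nat * nat)%type.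

Definition lazard_poly := monalg.malg (monalg.cmonom lazard_index) int.
HB.instance Definition _ := GRing.ComNzRing.on lazard_poly.

Definition lazard_gen (i j : nat) : lazard_poly :=
  monalg.mkmalgU (monalg.ucm (i, j)) 1.

Definition lazard_series : fps 2 lazard_poly :=
  var 1 lazard_poly 0 + var 1 lazard_poly 1 +
  Fps (fun m => let i := m (inord 0) in let j := m (inord 1) in
    if (0 < i)%N && (0 < j)%N then lazard_gen i.-1 j.-1 else 0).

Definition lazard_comm_defect : fps 2 lazard_poly :=
  fps2 lazard_series (var 1 lazard_poly 1) (var 1 lazard_poly 0) - lazard_series.

Definition lazard_assoc_defect : fps 3 lazard_poly :=
  let x := var 2 lazard_poly 0 in
  let y := var 2 lazard_poly 1 in
  let z := var 2 lazard_poly 2 in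
  let F := lazard_series in
  fps2 F (fps2 F x y) z - fps2 F x (fps2 F y z).

Definition lazard_relation (r : lazard_poly) : Prop :=
  (exists m, r = lazard_comm_defect m) \/ (exists m, r = lazard_assoc_defect m).

(* All relations vanish at c_ij = 0, i.e. for the additive formal group law. *)
Definition lazard_aug : {rmorphism lazard_poly -> int} :=
  (@monalg.mcoeff _ int monalg.one : lazard_poly -> int).

Lemma lazard_aug_series :
  fps_map lazard_aug lazard_series = var 1 int 0 + var 1 int 1.
Proof.
rewrite !fps_mapD !fps_map_var -[RHS]addr0; congr (_ + _).
apply: fpsP => m /=; case: ifP => _; last by rewrite mul0rn rmorph0.
rewrite mul0rn monalg.mcoeffU.
case: eqP => // /eqP/monalg.cmP/(_ ((m (inord 0)).-1, (m (inord 1)).-1)).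
by rewrite monalg.cmU monalg.cm1 eqxx.
Qed.

Lemma lazard_aug_relation r : lazard_relation r -> lazard_aug r = 0.
Proof.
case=> -[m ->].
  by rewrite -[LHS]/(fps_map lazard_aug lazard_comm_defect m)
    (fps_map_comm_defect lazard_aug_series); exact: mul0rn.
by rewrite -[LHS]/(fps_map lazard_aug lazard_assoc_defect m)
  (fps_map_assoc_defect lazard_aug_series); exact: mul0rn.
Qed.

Definition lazard_ideal : {pred lazard_poly} := gen_ideal lazard_relation.

Fact lazard_ideal_closed : idealr_closed lazard_ideal.
Proof. exact: gen_ideal_closed lazard_aug_relation. Qed.

HB.instance Definition _ := isIdealr.Build lazard_poly lazard_ideal
  lazard_ideal_closed.

Definition Omega_U := {ideal_quot lazard_ideal}.
HB.instance Definition _ := GRing.ComNzRing.on Omega_U.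

Definition Omega_pi (p : lazard_poly) : Omega_U := (\pi_Omega_U p)%qT.

Definition F_U : fps 2 Omega_U := fps_map Omega_pi lazard_series.

(* The grading deg c_ij = -2(i + j - 1), which makes F_U homogeneous of degree 2
   when deg u = deg v = 2. *)
Definition lazard_deg (m : monalg.cmonom lazard_index) : int :=
  - (\sum_(k <- finsupp m) m k * (2 * (k.1.+1 + k.2.+1 - 1)))%N%:Z.

Definition Omega_homog (d : int) (x : Omega_U) : Prop :=
  exists p : lazard_poly,
    (forall m, m \in monalg.msupp p -> d = lazard_deg m) /\ x = Omega_pi p.

Definition graded_hom (phi : Omega_U -> R_Bc) : Prop :=
  forall d x, Omega_homog d x -> R_Bc_homog d (phi x).

(* Main.v *)
(** With [X = u^-2] and [Y = sqrt(Q(u)) u^-3], the curve [Y^2 = X^3 - a1 X^2 + a2 X - a3]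
    is elliptic, and [F_Bc(u, v)^-2] is the [X]-coordinate of the third intersection point
    of the chord through the points of parameters [u] and [v], given there by the product
    of the roots of the cubic.  Hence [du / sqrt(Q(u))] is an invariant differential
    of [F_Bc]: up to units and powers of [u - v], the identity
    [(sqrt(Q(u)) dF/du)^2 = Q(F)] is a polynomial one, and square roots with constant
    term 1 are unique.  Both sides of associativity then solve the same ordinary
    differential equation in [x] with the same value at [x = 0]; as [R_Bc] has no torsion
    they agree.  The genus is the classifying map of [F_Bc] out of the Lazard ring, and it
    is graded because inverses and square roots of homogeneous series of weight 0 are
    fixed points of contractions preserving homogeneity. *)
Require Import Defs.
From HB Require Import structures.
From mathcomp Require Import all_boot all_order all_algebra.
From mathcomp Require Import finmap generic_quotient ring_quotient.
From mathcomp Require Import ring zify.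
From mathcomp Require boolp classical_sets.
From mathcomp.multinomials Require Import (canonicals, coercions) monalg.
From mathcomp.multinomials Require Import mpoly.

Set Implicit Arguments.
Unset Strict Implicit.
Unset Printing Implicit Defensive.

Import GRing.Theory.

Local Open Scope ring_scope.

(** * Coefficients of power series *)

Section Coefficients.
Variables (n : nat) (R : comNzRingType).
Implicit Types (f g h : fps n R) (m : 'X_{1..n}) (p q : {mpoly R[n]}).

Lemma fps_coefD f g m : (f + g) m = f m + g m. Proof. by []. Qed.
Lemma fps_coefN f m : (- f) m = - f m. Proof. by []. Qed.
Lemma fps_coefB f g m : (f - g) m = f m - g m. Proof. by []. Qed.
Lemma fps_coef0 m : (0 : fps n R) m = 0. Proof. exact: mul0rn. Qed.
Lemma fps_coef1 m : (1 : fps n R) m = (m == 0%MM)%:R. Proof. by []. Qed.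

Lemma fps_coef_sum I (r : seq I) (P : pred I) (F : I -> fps n R) m :
  (\sum_(i <- r | P i) F i) m = \sum_(i <- r | P i) F i m.
Proof. by elim/big_rec2: _ => [|i x y _ <-]; [exact: fps_coef0 | ]. Qed.

Definition fps_of_mpoly p : fps n R := Fps (fun m => p@_m).

(** Congruence modulo the [d]-th power of the ideal generated by the variables. Identities between
    series are reduced through it to identities between polynomials. *)
Definition fps_eqd d f g := forall m, (mdeg m < d)%N -> f m = g m.

Lemma fps_eqd_trunc d f : fps_eqd d f (fps_of_mpoly (fps_trunc d f)).
Proof. by move=> m lt_md; rewrite /= mcoeff_trunc. Qed.

Lemma fps_eqdP f g : (forall d, fps_eqd d f g) -> f = g.
Proof. by move=> fg; apply: fpsP => m; apply: (fg (mdeg m).+1). Qed.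

Lemma fps_coefM_eqd d f f' g g' :
  fps_eqd d f f' -> fps_eqd d g g' -> fps_eqd d (f * g) (f' * g').
Proof.
move=> ff' gg' m lt_md; apply: eq_bigr => -[[k /= _] [l /= _]] /= /eqP def_m.
have := lt_md; rewrite def_m mdegD => lt_d.
by rewrite ff' ?gg' // (leq_ltn_trans _ lt_d) ?leq_addr ?leq_addl.
Qed.

Lemma fps_coefM_eq0 f g m :
  (forall k l, m = (k + l)%MM -> f k * g l = 0) -> (f * g) m = 0.
Proof. by move=> fg0; apply: big1 => k /eqP; apply: fg0. Qed.

Definition fps_vanish d f := forall m, (mdeg m < d)%N -> f m = 0.

Lemma fps_vanishM d e f g :
  fps_vanish d f -> fps_vanish e g -> fps_vanish (d + e) (f * g).
Proof.
move=> fd ge m lt_m; apply: fps_coefM_eq0 => k l def_m.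
have [/fd->|le_dk] := ltnP (mdeg k) d; first exact: mul0r.
rewrite ge ?mulr0 // -(ltn_add2l d) (leq_ltn_trans _ lt_m) //.
by rewrite def_m mdegD leq_add2r.
Qed.

Lemma fps_vanish1 f : f 0%MM = 0 -> fps_vanish 1 f.
Proof. by move=> f0 m; rewrite ltnS leqn0 mdeg_eq0 => /eqP->. Qed.

Lemma fps_vanishX d f : f 0%MM = 0 -> fps_vanish d (f ^+ d).
Proof.
move=> f0; elim: d => // d IHd; rewrite exprS -add1n.
by apply: fps_vanishM => //; apply: fps_vanish1.
Qed.

Lemma fps_coef0M f g : (f * g) 0%MM = f 0%MM * g 0%MM.
Proof.
rewrite (@fps_mulE _ _ (f 0%MM)%:MP (g 0%MM)%:MP) => [|k|k].
- by rewrite -mpolyCM mcoeffC eqxx mulr1.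
- by rewrite mdeg0 leqn0 mdeg_eq0 => /eqP->; rewrite mcoeffC eqxx mulr1.
- by rewrite mdeg0 leqn0 mdeg_eq0 => /eqP->; rewrite mcoeffC eqxx mulr1.
Qed.

Lemma fps_of_mpolyM : {morph fps_of_mpoly : p q / p * q}.
Proof. by move=> p q; apply: fpsP => m; apply/esym/fps_mulE. Qed.

Lemma fps_of_mpolyD : {morph fps_of_mpoly : p q / p + q}.
Proof. by move=> p q; apply: fpsP => m; rewrite /= mcoeffD. Qed.

Lemma fps_of_mpolyC c : fps_of_mpoly c%:MP = fps_const c.
Proof. by apply: fpsP => m; rewrite /= mcoeffC mulr_natr eq_sym. Qed.

Lemma fps_of_mpolyX i : fps_of_mpoly 'X_i = fps_var i.
Proof. by apply: fpsP => m; rewrite /= mcoeffX eq_sym. Qed.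

Lemma fps_const_is_zmod_morphism : zmod_morphism (@fps_const n R).
Proof. by move=> a b; apply: fpsP => m; rewrite /= mulrnBl. Qed.

Lemma fps_const_is_monoid_morphism : monoid_morphism (@fps_const n R).
Proof.
split=> // a b.
by rewrite -!fps_of_mpolyC -fps_of_mpolyM mpolyCM.
Qed.

HB.instance Definition _ := GRing.isZmodMorphism.Build R (fps n R)
  (@fps_const n R) fps_const_is_zmod_morphism.
HB.instance Definition _ := GRing.isMonoidMorphism.Build R (fps n R)
  (@fps_const n R) fps_const_is_monoid_morphism.

(** Once series are truncated, the composition law and the chain rule only have to be checked on
    constants and variables. *)
Lemma mpoly_ring_ind (P : {mpoly R[n]} -> Prop) :
  (forall c, P c%:MP) -> (forall i, P 'X_i) ->
  (forall p q, P p -> P q -> P (p + q)) ->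
  (forall p q, P p -> P q -> P (p * q)) -> forall p, P p.
Proof.
move=> PC PX PD PM p; rewrite [p]mpolyE.
apply: big_ind => [||m _]; [by rewrite -mpolyC0 | exact: PD |].
rewrite -mul_mpolyC mpolyXE_id; apply: (PM) => //.
apply: big_ind => [||i _]; [by rewrite -mpolyC1 | exact: PM |].
elim: (m i) => [|k IHk]; first by rewrite expr0 -mpolyC1.
by rewrite exprS; apply: (PM).
Qed.

Lemma fps_coefVM i f m :
  (fps_var i * f) m = if (0 < m i)%N then f (m - U_(i))%MM else 0.
Proof.
case: ifP => [m_gt0|/negbT]; last first.
  rewrite -eqn0Ngt => /eqP m0; apply: fps_coefM_eq0 => k l def_m /=.
  have [Ek|_] := eqVneq; last exact: mul0r.
  by move: m0; rewrite def_m mnmDE Ek mnm1E eqxx.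
have def_m : m = (U_(i) + (m - U_(i)))%MM.
  by rewrite addmC submK //; apply/mnm_lepP => j; rewrite mnm1E; case: eqP => // <-.
rewrite (@fps_mulE _ _ 'X_i (fps_trunc (mdeg m).+1 f)).
- by rewrite mulrC [X in _@_X]def_m mcoeffMX mcoeff_trunc // ltnS mdegB.
- by move=> k _; rewrite /= mcoeffX eq_sym.
- by move=> k km; rewrite mcoeff_trunc.
Qed.

Lemma fps_var_coef0 i : (fps_var i : fps n R) 0%MM = 0.
Proof. by rewrite /= eq_sym mnm1_eq0. Qed.

Lemma fps_coefCM c f m : (fps_const c * f) m = c * f m.
Proof.
rewrite (@fps_mulE _ _ c%:MP (fps_trunc (mdeg m).+1 f)) ?mcoeffCM ?mcoeff_trunc //.
  by move=> k _; rewrite /= mcoeffC mulr_natr eq_sym.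
by move=> k km; rewrite mcoeff_trunc.
Qed.

End Coefficients.

(** * Substitution and derivations *)

Section Substitution.
Variables (R : comNzRingType) (n k : nat) (g : n.-tuple (fps k R)).
Implicit Types (F G : fps n R).

(** Under this condition the monomial of exponent [a] in the [g_i] has order at least [mdeg a], so
    the truncated sum defining [fps_subst] is the full one. *)
Definition nilpotent_subst := forall i, tnth g i 0%MM = 0.

Lemma fps_subst_eqd d F G :
  fps_eqd d F G -> fps_eqd d (fps_subst F g) (fps_subst G g).
Proof.
move=> FG m lt_md; apply: eq_bigr => a _; rewrite FG //.
by apply: leq_ltn_trans lt_md; rewrite -ltnS bmdeg.
Qed.

Lemma fps_subst_coef0 F : fps_subst F g 0%MM = F 0%MM.
Proof.
have lt0 : (mdeg (0 : 'X_{1..n}) < (mdeg (0 : 'X_{1..k})).+1)%N by rewrite !mdeg0.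
rewrite /= (bigD1 (BMultinom lt0)) //= [X in _ + X]big1 ?addr0 => [|a]; last first.
  rewrite bmeqP /= -mdeg_eq0 -leqn0 => /negP[].
  by rewrite -ltnS (leq_trans (bmdeg a)) // mdeg0.
rewrite big1 => [|i _]; last by rewrite mnm0E expr0.
by rewrite fps_coef1 eqxx mulr1.
Qed.

Hypothesis g0 : nilpotent_subst.

Lemma fps_vanish_mmap1 (a : 'X_{1..n}) :
  fps_vanish (mdeg a) (\prod_(i < n) tnth g i ^+ a i).
Proof.
rewrite mdegE; elim/big_rec2: _ => // i d f _ IHf.
by apply: fps_vanishM => //; apply: fps_vanishX.
Qed.


Lemma fps_vanish_mmap d (p : {mpoly R[n]}) :
    (forall m, (mdeg m < d)%N -> p@_m = 0) ->
  fps_vanish d (mmap (@fps_const k R) (tnth g) p).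
Proof.
move=> pd m lt_md; rewrite fps_coef_sum big1 // => a _.
have [/pd->|le_da] := ltnP (mdeg a) d; first by rewrite rmorph0 mul0r fps_coef0.
by rewrite fps_coefCM fps_vanish_mmap1 ?mulr0 // (leq_trans lt_md).
Qed.

(** The truncation in [fps_subst] depends on the coefficient [m] that is read, unlike [mmap]. The
    difference between [p] and the truncation of [F] starts above degree [mdeg m], and so does its
    value at [g]. *)
Lemma fps_subst_eqd_mmap d F (p : {mpoly R[n]}) :
    (forall m, (mdeg m < d)%N -> F m = p@_m) ->
  fps_eqd d (fps_subst F g) (mmap (@fps_const k R) (tnth g) p).
Proof.
move=> Fp m lt_md; pose q := fps_trunc (mdeg m).+1 F.
have size_q : (msize q <= (mdeg m).+1)%N.
  apply: leq_trans (msize_sum _ _ _) _; apply/bigmax_leqP => a _.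
  apply: leq_trans (msizeZ_le _ _) _; rewrite msizeX; exact: bmdeg.
have -> : p = q + (p - q) by rewrite addrC subrK.
rewrite mmapD fps_coefD [X in _ = _ + X](@fps_vanish_mmap (mdeg m).+1) //.
  rewrite addr0 (mmapE _ size_q) fps_coef_sum; apply: eq_bigr => a _.
  by rewrite fps_coefCM mcoeff_trunc ?bmdeg.
move=> a lt_am; rewrite mcoeffB mcoeff_trunc // Fp ?subrr //.
by apply: leq_ltn_trans lt_md; rewrite -ltnS.
Qed.

Lemma fps_subst_mpoly (p : {mpoly R[n]}) :
  fps_subst (fps_of_mpoly p) g = mmap (@fps_const k R) (tnth g) p.
Proof. by apply: fps_eqdP => d; apply: fps_subst_eqd_mmap. Qed.

Lemma fps_substD : {morph (fun F => fps_subst F g) : F G / F + G}.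
Proof.
move=> F G; apply: fpsP => m; rewrite fps_coefD /= -big_split /=.
by apply: eq_bigr => a _; rewrite mulrDl.
Qed.

Lemma fps_substN : {morph (fun F => fps_subst F g) : F / - F}.
Proof.
move=> F; apply: fpsP => m; rewrite fps_coefN /= -sumrN.
by apply: eq_bigr => a _; rewrite mulNr.
Qed.

Lemma fps_substB : {morph (fun F => fps_subst F g) : F G / F - G}.
Proof. by move=> F G; rewrite fps_substD fps_substN. Qed.

(** Below degree [d] both factors may be replaced by polynomials, on which substitution is the ring
    morphism [mmap]. *)
Lemma fps_substM : {morph (fun F => fps_subst F g) : F G / F * G}.
Proof.
move=> F G; apply: fps_eqdP => d; pose T (f : fps n R) := fps_trunc d f.
have FG : fps_eqd d (F * G) (fps_of_mpoly (T F * T G)).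
  by rewrite fps_of_mpolyM; apply: fps_coefM_eqd; apply: fps_eqd_trunc.
have gT H : fps_eqd d (mmap (@fps_const k R) (tnth g) (T H)) (fps_subst H g).
  move=> m lt_md; rewrite (@fps_subst_eqd_mmap d _ (T H)) // => a lt_ad.
  by rewrite mcoeff_trunc.
move=> m lt_md; rewrite (fps_subst_eqd_mmap FG) // rmorphM /=.
exact: fps_coefM_eqd (gT F) (gT G) m lt_md.
Qed.

Lemma fps_substC c : fps_subst (fps_const c) g = fps_const c.
Proof. by rewrite -fps_of_mpolyC fps_subst_mpoly mmapC. Qed.

Lemma fps_subst1 : fps_subst 1 g = 1.
Proof. exact: fps_substC. Qed.

Lemma fps_subst0 : fps_subst 0 g = 0.
Proof. by rewrite -[0](rmorph0 (@fps_const n R)) fps_substC rmorph0. Qed.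

Lemma fps_substV i : fps_subst (fps_var i) g = tnth g i.
Proof. by rewrite -fps_of_mpolyX fps_subst_mpoly mmapX mmap1U. Qed.

Lemma fps_substX F e : fps_subst (F ^+ e) g = fps_subst F g ^+ e.
Proof. by elim: e => [|e IHe]; rewrite ?expr0 ?fps_subst1 // !exprS fps_substM IHe. Qed.

End Substitution.

Section Composition.
Variables (R : comNzRingType) (n k l : nat).
Variables (g : n.-tuple (fps k R)) (h : k.-tuple (fps l R)).
Hypotheses (g0 : nilpotent_subst g) (h0 : nilpotent_subst h).

Let gh := map_tuple (fun f => fps_subst f h) g.

Lemma nilpotent_subst_comp : nilpotent_subst gh.
Proof. by move=> i; rewrite tnth_map fps_subst_coef0. Qed.

Lemma fps_substA F : fps_subst (fps_subst F g) h = fps_subst F gh.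
Proof.
have gh0 := nilpotent_subst_comp.
apply: fps_eqdP => d; pose p := fps_trunc d F.
have Fp : fps_eqd d F (fps_of_mpoly p) by apply: fps_eqd_trunc.
move=> m lt_md; rewrite (fps_subst_eqd h (fps_subst_eqd g Fp)) //.
rewrite (fps_subst_eqd gh Fp) // !fps_subst_mpoly //.
congr (fps_coef _ m); elim/mpoly_ring_ind: p {Fp} => [c|i|p q|p q].
- by rewrite !mmapC fps_substC.
- by rewrite !mmapX !mmap1U tnth_map.
- by rewrite !mmapD fps_substD => -> ->.
- by rewrite !rmorphM /= fps_substM // => -> ->.
Qed.

End Composition.

Section Derivation.
Variables (n : nat) (R : comNzRingType).
Implicit Types (f g : fps n R) (i : 'I_n).

Definition fps_deriv i f : fps n R :=
  Fps (fun m => f (m + U_(i))%MM *+ (m i).+1).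

Lemma fps_derivD i : {morph fps_deriv i : f g / f + g}.
Proof. by move=> f g; apply: fpsP => m; rewrite /= mulrnDl. Qed.

Lemma fps_derivN i : {morph fps_deriv i : f / - f}.
Proof. by move=> f; apply: fpsP => m; rewrite /= mulNrn. Qed.

Lemma fps_derivB i : {morph fps_deriv i : f g / f - g}.
Proof. by move=> f g; rewrite fps_derivD fps_derivN. Qed.

Lemma fps_deriv_of_mpoly i (p : {mpoly R[n]}) :
  fps_deriv i (fps_of_mpoly p) = fps_of_mpoly p^`M(i).
Proof. by apply: fpsP => m; rewrite /= mcoeff_mderiv. Qed.

Lemma fps_deriv_eqd i d f g :
  fps_eqd d.+1 f g -> fps_eqd d (fps_deriv i f) (fps_deriv i g).
Proof. by move=> fg m lt_md; rewrite /= fg // mdegD mdeg1 addn1. Qed.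

Lemma fps_eqdW d e f g : (d <= e)%N -> fps_eqd e f g -> fps_eqd d f g.
Proof. by move=> le_de fg m lt_md; apply: fg (leq_trans lt_md le_de). Qed.

Lemma fps_derivC i c : fps_deriv i (fps_const c) = 0.
Proof.
apply: fpsP => m; rewrite fps_coef0 /= -mdeg_eq0 mdegD mdeg1 addn1.
by rewrite mulr0n mul0rn.
Qed.

Lemma fps_derivV i j : fps_deriv i (fps_var j) = (i == j)%:R.
Proof.
rewrite -fps_of_mpolyX fps_deriv_of_mpoly mderivX mnm1E eq_sym.
have [->|_] := eqVneq i j; last first.
  by rewrite scale0r -mpolyC0 fps_of_mpolyC rmorph0.
by rewrite scale1r -[X in (X - _)%MM]add0m addmK mpolyX0 -mpolyC1 fps_of_mpolyC rmorph1.
Qed.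

Lemma fps_derivM i f g :
  fps_deriv i (f * g) = fps_deriv i f * g + f * fps_deriv i g.
Proof.
apply: fps_eqdP => d; pose T (h : fps n R) := fps_trunc d.+1 h.
have fT h : fps_eqd d.+1 h (fps_of_mpoly (T h)) by apply: fps_eqd_trunc.
have fT' h : fps_eqd d h (fps_of_mpoly (T h)) by apply: fps_eqdW (fT h).
move=> m lt_md; rewrite (fps_deriv_eqd i (fps_coefM_eqd (fT f) (fT g))) //.
rewrite -fps_of_mpolyM fps_deriv_of_mpoly mderivM fps_of_mpolyD !fps_of_mpolyM.
rewrite -!fps_deriv_of_mpoly !fps_coefD; congr (_ + _).
all: by apply/esym/(fps_coefM_eqd _ _ lt_md) => //; apply: fps_deriv_eqd.
Qed.

End Derivation.

(** After reduction to polynomials, both sides obey the same sum and product rules. The truncation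
    is at [d.+1] because a derivative below degree [d] reads coefficients of degree up to [d]. *)
Lemma fps_deriv_subst (R : comNzRingType) n k i (F : fps n R)
    (g : n.-tuple (fps k R)) : nilpotent_subst g ->
  fps_deriv i (fps_subst F g) =
  \sum_(j < n) fps_subst (fps_deriv j F) g * fps_deriv i (tnth g j).
Proof.
move=> g0; apply: fps_eqdP => d; pose p := fps_trunc d.+1 F.
have Fp : fps_eqd d.+1 F (fps_of_mpoly p) by apply: fps_eqd_trunc.
move=> m lt_md; rewrite (fps_deriv_eqd i (fps_subst_eqd _ Fp)) //.
transitivity ((\sum_(j < n) fps_subst (fps_deriv j (fps_of_mpoly p)) g *
                            fps_deriv i (tnth g j)) m); last first.
  rewrite !fps_coef_sum; apply: eq_bigr => j _.
  apply/esym/(fps_coefM_eqd _ _ lt_md) => //.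
  exact/fps_subst_eqd/fps_deriv_eqd.
congr (fps_coef _ m); rewrite fps_subst_mpoly //.
under eq_bigr => j _ do rewrite fps_deriv_of_mpoly fps_subst_mpoly //.
elim/mpoly_ring_ind: p {Fp} => [c|j|p q IHp IHq|p q IHp IHq].
- rewrite mmapC fps_derivC big1 // => j _.
  by rewrite mderivC mmap0 mul0r.
- rewrite mmapX mmap1U (bigD1 j) //= mderivX mnm1E eqxx scale1r -[X in (X - _)%MM]add0m addmK.
  rewrite mmapX mmap11 mul1r big1 ?addr0 // => l lj.
  by rewrite mderivX mnm1E eq_sym (negbTE lj) scale0r mmap0 mul0r.
- rewrite mmapD fps_derivD IHp IHq -big_split /=; apply: eq_bigr => j _.
  by rewrite mderivD mmapD mulrDl.
- rewrite rmorphM /= fps_derivM IHp IHq mulr_suml mulr_sumr -big_split /=.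
  by apply: eq_bigr => j _; rewrite mderivM mmapD !rmorphM /=; ring.
Qed.

(** * Contractions, inverses and square roots *)

(** The contraction principle for the degree filtration. Each coefficient of the limit is a
    coefficient of an iterate of [T] from 0, so a coefficientwise property [P] kept by [T] passes to
    the limit; [P] will be homogeneity. *)
Lemma fps_fixpoint n (R : comNzRingType) (T : fps n R -> fps n R)
    (P : 'X_{1..n} -> R -> Prop) :
    (forall d f g, fps_eqd d f g -> fps_eqd d.+1 (T f) (T g)) ->
    (forall m, P m 0) ->
    (forall f : fps n R, (forall m, P m (f m)) -> forall m, P m (T f m)) ->
  exists g : fps n R, T g = g /\ forall m, P m (g m).
Proof.
move=> contrT P0 PT; pose it d := iter d T 0.
have itP d m : P m (it d m).
  elim: d m => [|d IHd] m; last exact: PT.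
  by rewrite fps_coef0.
have itS d e : fps_eqd d (it d) (it (d + e)%N).
  by elim: d => // d IHd; rewrite addSn; apply: contrT.
(* Iterates agree below degree [d] from the [d]-th one on, so the coefficient at [m] is final at
   iterate [mdeg m + 1]. *)
pose g := Fps (fun m => it (mdeg m).+1 m).
have gE d : fps_eqd d g (it d).
  move=> m lt_md.
  transitivity (it ((mdeg m).+1 + (d - (mdeg m).+1))%N m); first exact: itS.
  by rewrite subnKC.
exists g; split=> [|m]; last exact: itP.
apply: fps_eqdP => d m lt_md.
by rewrite (contrT _ _ _ (gE d)) ?(gE d.+1) // ltnW.
Qed.

Section Units.
Variables (n : nat) (R : comNzRingType).
Implicit Types (f g h : fps n R).

Lemma fps_eqdMl d f g h : h 0%MM = 0 -> fps_eqd d f g ->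
  fps_eqd d.+1 (h * f) (h * g).
Proof.
move=> h0 fg m lt_md; apply/eqP; rewrite -subr_eq0 -fps_coefB -mulrBr; apply/eqP.
apply: (@fps_vanishM _ _ 1 d) lt_md; first exact: fps_vanish1.
by move=> k lt_kd; rewrite fps_coefB fg ?subrr.
Qed.

(** The inverse is the fixed point of [g -> 1 + (1 - f) g], a contraction because [1 - f] has no
    constant term. *)
Lemma fps_inv_ind (P : 'X_{1..n} -> R -> Prop) f :
    f 0%MM = 1 -> (forall m, P m 0) ->
    (forall g, (forall m, P m (g m)) -> forall m, P m ((1 + (1 - f) * g) m)) ->
  f \is a GRing.unit /\ forall m, P m (f^-1 m).
Proof.
move=> f0 P0 PT; pose T g := 1 + (1 - f) * g.
have [|g [Tg Pg]] := @fps_fixpoint n R T P _ P0 PT.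
  move=> d g h gh m lt_md; rewrite /T !fps_coefD (@fps_eqdMl d g h) //.
  by rewrite fps_coefB f0 fps_coef1 eqxx subrr.
have gf : g * f = 1.
  by apply/esym/subr0_eq; rewrite -[RHS](subrr g) -{2}Tg /T; ring.
have fU : f \is a GRing.unit by apply/unitrP; exists g; rewrite [f * g]mulrC gf.
by split=> // m; rewrite -[f^-1]mul1r -gf mulrK.
Qed.

Lemma fps_unit1 f : f 0%MM = 1 -> f \is a GRing.unit.
Proof. by move=> f0; have [] := @fps_inv_ind (fun _ _ => True) f. Qed.

Section Sqrt.
Variable half : R.
Hypothesis halfP : 2%:R * half = 1.

(** Half of [f + g] has constant term 1, hence is a unit that can be cancelled from
    [(f - g)(f + g) = 0]. *)
Lemma fps_sqr_inj f g : f 0%MM = 1 -> g 0%MM = 1 -> f ^+ 2 = g ^+ 2 -> f = g.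
Proof.
move=> f0 g0 fg; apply/eqP; rewrite -subr_eq0; apply/eqP.
have kU : fps_const half * (f + g) \is a GRing.unit.
  by apply: fps_unit1; rewrite fps_coefCM fps_coefD f0 g0 mulrC; apply: halfP.
apply: (mulIr kU); rewrite mul0r.
transitivity (fps_const half * (f ^+ 2 - g ^+ 2)); first by ring.
by rewrite fg subrr mulr0.
Qed.

Lemma fps_sqrt_ind (P : 'X_{1..n} -> R -> Prop) f :
    f 0%MM = 1 -> (forall m, P m 0) ->
    (forall g, (forall m, P m (g m)) -> forall m,
       P m ((fps_const half * (f - 1 - (g - fps_const (g 0%MM)) ^+ 2)) m)) ->
  exists g, [/\ g 0%MM = 0, (1 + g) ^+ 2 = f & forall m, P m (g m)].
Proof.
move=> f0 P0 PT.
(* A root [1 + g] of [f] satisfies [g = (f - 1 - g^2) / 2]. Subtracting the constant term of [g]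
   makes this a contraction on all series; the fixed point has constant term 0, so the correction
   disappears there. *)
pose T g := fps_const half * (f - 1 - (g - fps_const (g 0%MM)) ^+ 2).
have c0 g : (g - fps_const (g 0%MM)) 0%MM = 0.
  by rewrite fps_coefB /= eqxx subrr.
have [|g [Tg Pg]] := @fps_fixpoint n R T P _ P0 PT.
  move=> d g h gh m lt_md; rewrite /T !fps_coefCM; congr (_ * _).
  rewrite !fps_coefB; congr (_ - _); apply/eqP.
  rewrite -subr_eq0 -fps_coefB subr_sqr mulrC; apply/eqP.
  apply: (@fps_vanishM _ _ 1 d) lt_md => [|k lt_kd].
    by apply: fps_vanish1; rewrite fps_coefD !c0 addr0.
  rewrite !fps_coefB /= gh // [g 0%MM]gh ?subrr // mdeg0.
  exact: leq_ltn_trans lt_kd.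
have g0 : g 0%MM = 0.
  by rewrite -Tg /T fps_coefCM !fps_coefB f0 expr2 fps_coef0M c0 fps_coef1 eqxx;
    rewrite mul0r !subrr mulr0.
exists g; split=> //.
have g2 : 2%:R * g = f - 1 - g ^+ 2.
  rewrite -{1}Tg /T g0 rmorph0 subr0 mulrA -(rmorph_nat (@fps_const n R)).
  by rewrite -rmorphM halfP rmorph1 mul1r.
transitivity (1 + 2%:R * g + g ^+ 2); first by ring.
by rewrite g2; ring.
Qed.

Lemma fps_sqrtP f : f 0%MM = 1 -> fps_sqrt f 0%MM = 1 /\ fps_sqrt f ^+ 2 = f.
Proof.
move=> f0; have [||g [g0 g2 _]] := @fps_sqrt_ind (fun _ _ => True) f f0; try by [].
have gE : (1 + g) 0%MM = 1 by rewrite fps_coefD g0 addr0 fps_coef1 eqxx.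
exact: (@classical_sets.xgetPex _ 0 (fun h => h 0%MM = 1 /\ h ^+ 2 = f)
  (ex_intro _ (1 + g) (conj gE g2))).
Qed.

End Sqrt.
End Units.

(** * Cancelling variables and their differences; setting a variable to 0 *)

Section Variables.
Variables (n : nat) (R : comNzRingType).
Implicit Types (f g h : fps n R) (i j : 'I_n).

Lemma fps_varM_inj i f g : fps_var i * f = fps_var i * g -> f = g.
Proof.
move=> fg; apply: fpsP => m.
have := congr1 (fun h : fps n R => h (m + U_(i))%MM) fg.
by rewrite !fps_coefVM mnmDE mnm1E eqxx addn1 /= addmK.
Qed.

(** If [(x_i - x_j) h = 0], the coefficient of [h] at [m] equals the one at [m + U_(i) - U_(j)], or
    is 0 when [x_j] does not occur in [m]. Induction on the exponent of [x_j] kills [h] over any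
    coefficient ring. *)
Lemma fps_varB_inj i j f g : i != j ->
  (fps_var i - fps_var j) * f = (fps_var i - fps_var j) * g -> f = g.
Proof.
move=> ij /eqP; rewrite -subr_eq0 -mulrBr => /eqP fg0.
apply/eqP; rewrite -subr_eq0; apply/eqP; move: (f - g) fg0 => {f g} h h0.
suffices hj d (m : 'X_{1..n}) : m j = d -> h m = 0 by apply: fpsP => m; rewrite fps_coef0 (hj (m j)).
elim: d m => [|d IHd] m mj; have := congr1 (fun f : fps n R => f (m + U_(i))%MM) h0.
all: rewrite mulrBl fps_coefB !fps_coefVM !mnmDE !mnm1E eqxx (negbTE ij) addn0 addn1 fps_coef0.
all: rewrite mj /= addmK ?subr0 // [X in _ - X]IHd ?subr0 //.
by rewrite mnmBE mnmDE !mnm1E eqxx (negbTE ij) mj addn0 subn1.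
Qed.

Lemma fps_varX i d : fps_var i ^+ d = fps_of_mpoly 'X_[U_(i) *+ d] :> fps n R.
Proof.
elim: d => [|d IHd]; first by rewrite mulm0n mpolyX0 -mpolyC1 fps_of_mpolyC.
by rewrite exprS IHd mulmS mpolyXD fps_of_mpolyM fps_of_mpolyX.
Qed.

Lemma fps1_varE (p : fps 1 R) i m :
  fps1 p (fps_var i) m = p (U_(ord0) *+ mdeg m)%MM *+ (m == U_(i) *+ mdeg m)%MM.
Proof.
have E (a : 'X_{1..1}) :
    (\prod_(l < 1) tnth [tuple (fps_var i : fps n R)] l ^+ a l) m =
    (U_(i) *+ a ord0 == m)%MM%:R.
  by rewrite big_ord1 (tnth_nth 0) /= fps_varX /= mcoeffX.
have a1 (a : 'X_{1..1}) : a = (U_(ord0) *+ a ord0)%MM.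
  by apply/mnmP => l; rewrite (ord1 l) mulmnE mnm1E eqxx mul1n.
rewrite /=; under eq_bigr => a _ do rewrite E.
have [def_m|ne_m] := eqVneq m (U_(i) *+ mdeg m)%MM; last first.
  rewrite big1 // => a _; case: eqP => [def_m|_]; last exact: mulr0.
  by case/eqP: ne_m; rewrite -def_m mdegMn mdeg1 mul1n.
have lt_m : (mdeg (U_(ord0 : 'I_1) *+ mdeg m) < (mdeg m).+1)%N.
  by rewrite mdegMn mdeg1 mul1n.
rewrite (bigD1 (BMultinom lt_m)) //= mulmnE mnm1E eqxx mul1n -def_m eqxx mulr1.
rewrite big1 ?addr0 // => a; rewrite bmeqP /= => ne_a.
case: eqP => [Em|_]; last exact: mulr0.
have := congr1 mdeg Em; rewrite mdegMn mdeg1 mul1n => Ea.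
by case/eqP: ne_a; rewrite [LHS]a1 Ea.
Qed.

(** Setting [x_i = 0] does not affect the monomials free of [x_i]. This reads off initial values of
    differential equations and the unit axioms on coefficients. *)
Lemma fps_subst_restr i (s : n.-tuple (fps n R)) f (m : 'X_{1..n}) :
    tnth s i = 0 -> (forall j, j != i -> tnth s j = fps_var j) -> m i = 0%N ->
  fps_subst f s m = f m.
Proof.
move=> si sj mi.
have E (a : 'X_{1..n}) : (\prod_(j < n) tnth s j ^+ a j) m = (a == m)%:R.
  have [ai|ai] := eqVneq (a i) 0%N.
    rewrite (eq_bigr (fun j => fps_var j ^+ a j)) => [|j _]; last first.
      by have [->|/sj->] := eqVneq j i; rewrite // ai !expr0.
    rewrite -mcoeffX mpolyXE_id -[RHS]/(fps_of_mpoly _ m); congr (fps_coef _ m).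
    rewrite (big_morph (@fps_of_mpoly n R) (@fps_of_mpolyM n R) (id1 := 1)); last first.
      by rewrite -mpolyC1 fps_of_mpolyC.
    apply: eq_bigr => j _; rewrite fps_varX; congr fps_of_mpoly.
    by rewrite mpolyXn.
  have -> : \prod_(j < n) tnth s j ^+ a j = 0.
    by rewrite (bigD1 i) //= si expr0n (negbTE ai) mul0r.
  rewrite fps_coef0.
  by case: eqP => // Ea; rewrite Ea mi in ai.
rewrite /=; under eq_bigr => a _ do rewrite E.
have lt_m : (mdeg m < (mdeg m).+1)%N by [].
rewrite (bigD1 (BMultinom lt_m)) //= eqxx mulr1 big1 ?addr0 // => a.
by rewrite bmeqP /= => /negbTE->; rewrite mulr0.
Qed.

End Variables.

(** * Associativity from an invariant differential *)

Lemma ord2E (j : 'I_2) : j = inord 0 \/ j = inord 1.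
Proof. by case: j => [[|[]]] // lt_j2; [left | right]; apply: val_inj; rewrite /= inordK. Qed.

Lemma ord2_neq : (inord 0 == inord 1 :> 'I_2) = false.
Proof. by apply/eqP => /(congr1 val); rewrite /= !inordK. Qed.

(** * Substitution into series in one and two variables *)

Section BinarySubstitution.
Variables (R : comNzRingType) (k : nat).
Implicit Types (f g h : fps k R).

Lemma tnth_pair0 (T : Type) (x y : T) : tnth [tuple x; y] (inord 0) = x.
Proof. by rewrite (tnth_nth x) inordK. Qed.

Lemma tnth_pair1 (T : Type) (x y : T) : tnth [tuple x; y] (inord 1) = y.
Proof. by rewrite (tnth_nth x) inordK. Qed.

Lemma nilpotent1 g : g 0%MM = 0 -> nilpotent_subst [tuple g].
Proof. by move=> g0 i; rewrite (ord1 i). Qed.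

Lemma nilpotent2 g h :
  g 0%MM = 0 -> h 0%MM = 0 -> nilpotent_subst [tuple g; h].
Proof. by move=> g0 h0 i; have [->|->] := ord2E i; rewrite ?tnth_pair0 ?tnth_pair1. Qed.

Lemma fps2_coef0 (F : fps 2 R) g h : fps2 F g h 0%MM = F 0%MM.
Proof. exact: fps_subst_coef0. Qed.

Lemma fps1_coef0 (F : fps 1 R) g : fps1 F g 0%MM = F 0%MM.
Proof. exact: fps_subst_coef0. Qed.

Lemma fps2_var0 g h : g 0%MM = 0 -> h 0%MM = 0 -> fps2 (var 1 R 0) g h = g.
Proof.
move=> g0 h0; rewrite -[RHS](tnth_pair0 g h).
exact/fps_substV/nilpotent2.
Qed.

Lemma fps2_var1 g h : g 0%MM = 0 -> h 0%MM = 0 -> fps2 (var 1 R 1) g h = h.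
Proof.
move=> g0 h0; rewrite -[RHS](tnth_pair1 g h).
exact/fps_substV/nilpotent2.
Qed.

Lemma fps1_var g : g 0%MM = 0 -> fps1 (var 0 R 0) g = g.
Proof.
by move=> g0; rewrite /fps1 /var fps_substV ?(ord1 (inord 0)) //; apply: nilpotent1.
Qed.

Lemma var_coef0 n i : var n R i 0%MM = 0.
Proof. exact: fps_var_coef0. Qed.

Lemma fps_deriv2 i (F : fps 2 R) g h : g 0%MM = 0 -> h 0%MM = 0 ->
  fps_deriv i (fps2 F g h) =
    fps2 (fps_deriv (inord 0) F) g h * fps_deriv i g +
    fps2 (fps_deriv (inord 1) F) g h * fps_deriv i h.
Proof.
move=> g0 h0; rewrite fps_deriv_subst; last exact: nilpotent2.
rewrite big_ord_recl big_ord_recl big_ord0 addr0.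
have -> : lift ord0 ord0 = inord 1 :> 'I_2.
  by apply: val_inj; rewrite /= inordK.
have -> : ord0 = inord 0 :> 'I_2 by apply: val_inj; rewrite /= inordK.
by rewrite tnth_pair0 tnth_pair1.
Qed.

Section Outer.
Variables (l : nat) (s : k.-tuple (fps l R)).
Hypothesis s0 : nilpotent_subst s.

Lemma fps_subst_fps2 (F : fps 2 R) g h : g 0%MM = 0 -> h 0%MM = 0 ->
  fps_subst (fps2 F g h) s = fps2 F (fps_subst g s) (fps_subst h s).
Proof.
move=> g0 h0; rewrite /fps2 fps_substA //; last exact: nilpotent2.
by congr fps_subst; apply: val_inj.
Qed.

Lemma fps_subst_fps1 (p : fps 1 R) g : g 0%MM = 0 ->
  fps_subst (fps1 p g) s = fps1 p (fps_subst g s).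
Proof.
move=> g0; rewrite /fps1 fps_substA //; last exact: nilpotent1.
by congr fps_subst; apply: val_inj.
Qed.

End Outer.
End BinarySubstitution.

(** This is [(p(u) - p(v)) / (u - v)], since [(u^(k+1) - v^(k+1)) / (u - v)] is the sum of all
    monomials of degree [k]. *)
Definition fps_diff_quotient (R : comNzRingType) (p : fps 1 R) : fps 2 R :=
  Fps (fun m => p (U_(ord0) *+ (mdeg m).+1)%MM).

Lemma fps_diff_quotientE (R : comNzRingType) (p : fps 1 R) :
  fps1 p (var 1 R 0) - fps1 p (var 1 R 1) =
  (var 1 R 0 - var 1 R 1) * fps_diff_quotient p.
Proof.
apply: fpsP => m; rewrite mulrBl !fps_coefB /var !fps1_varE !fps_coefVM /=.
have degB i : (0 < m i)%N -> (mdeg (m - U_(i))).+1 = mdeg m.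
  move=> mi; have le_im : (U_(i) <= m)%MM.
    by apply/mnm_lepP => j; rewrite mnm1E; case: eqP => // <-.
  by rewrite -[in RHS](submK le_im) mdegD mdeg1 addn1.
have deg2 : mdeg m = (m (inord 0) + m (inord 1))%N.
  rewrite mdegE big_ord_recl big_ord_recl big_ord0 addn0; congr (m _ + m _)%N.
    by apply: val_inj; rewrite /= inordK.
  by apply: val_inj; rewrite /= inordK.
have -> : (m == U_(inord 0) *+ mdeg m)%MM = (m (inord 1) == 0%N).
  apply/eqP/eqP => [->|m1]; first by rewrite mulmnE mnm1E ord2_neq.
  apply/mnmP => j; rewrite mulmnE mnm1E deg2 m1 addn0.
  by have [->|->] := ord2E j; rewrite ?eqxx ?mul1n // ord2_neq m1.
have -> : (m == U_(inord 1) *+ mdeg m)%MM = (m (inord 0) == 0%N).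
  apply/eqP/eqP => [->|m0]; first by rewrite mulmnE mnm1E eq_sym ord2_neq.
  apply/mnmP => j; rewrite mulmnE mnm1E deg2 m0 add0n.
  by have [->|->] := ord2E j; rewrite ?eqxx ?mul1n // eq_sym ord2_neq m0.
case: posnP => [m0|m0]; case: posnP => [m1|m1].
all: by rewrite ?degB ?m0 ?m1 ?subrr ?subr0 ?eqxx -?lt0n ?m0 ?m1 //= ?mulr1n ?mulr0n
     ?subrr ?subr0 ?sub0r.
Qed.

(** In a linear equation, a coefficient of [f] with exponent [d + 1] in [x_i], multiplied by
    [d + 1], is a combination of coefficients with exponent at most [d]. Without torsion, induction
    on [d] kills them all. *)
Lemma fps_ode_eq0 (R : comNzRingType) n (i : 'I_n) (f g : fps n R) :
    (forall d (x : R), x *+ d.+1 = 0 -> x = 0) ->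
    fps_deriv i f = g * f -> (forall m : 'X_{1..n}, m i = 0%N -> f m = 0) ->
  f = 0.
Proof.
move=> torsion_free odef f0.
suffices fd d (m : 'X_{1..n}) : (m i <= d)%N -> f m = 0.
  by apply: fpsP => m; rewrite fps_coef0 (fd (m i)).
elim: d m => [|d IHd] m; first by rewrite leqn0 => /eqP; apply: f0.
rewrite leq_eqVlt => /orP[/eqP mi|]; last exact: IHd.
have def_m : m = (m - U_(i) + U_(i))%MM.
  by rewrite submK //; apply/mnm_lepP => j; rewrite mnm1E; case: eqP => // <-; rewrite mi.
apply: (torsion_free (m i).-1).
have := congr1 (fun h : fps n R => h (m - U_(i))%MM) odef.
rewrite /= -def_m mnmBE mnm1E eqxx subn1 => ->.
apply: fps_coefM_eq0 => k l /(congr1 (fun a : 'X_{1..n} => a i)).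
rewrite mnmBE mnm1E eqxx mnmDE mi subn1 /= => di.
by rewrite IHd ?mulr0 // di leq_addl.
Qed.

(* The differential equation says that [dt / p(t)] is an invariant differential
   of F; both sides of associativity then solve [p(x) dA/dx = p(A)] with the
   same value at [x = 0]. *)
Lemma fps_assoc_of_invariant_differential (R : comNzRingType)
    (F : fps 2 R) (p : fps 1 R) :
    (forall d (x : R), x *+ d.+1 = 0 -> x = 0) ->
    p 0%MM = 1 -> F 0%MM = 0 -> fps2 F 0 (var 0 R 0) = var 0 R 0 ->
    fps1 p (var 1 R 0) * fps_deriv (inord 0) F = fps1 p F ->
  let x := var 2 R 0 in let y := var 2 R 1 in let z := var 2 R 2 in
  fps2 F (fps2 F x y) z = fps2 F x (fps2 F y z).
Proof.
move=> torsion_free p0 F0 F0t dF x y z.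
have [x0 y0 z0] : [/\ x 0%MM = 0, y 0%MM = 0 & z 0%MM = 0].
  by split; apply: var_coef0.
have F00 k (g h : fps k R) : fps2 F g h 0%MM = 0 by rewrite fps2_coef0.
have dFsubst k (g h : fps k R) : g 0%MM = 0 -> h 0%MM = 0 ->
    fps1 p g * fps2 (fps_deriv (inord 0) F) g h = fps1 p (fps2 F g h).
  move=> g0 h0; have gh0 := nilpotent2 g0 h0.
  have := congr1 (fun f => fps_subst f [tuple g; h]) dF.
  rewrite /= fps_substM // !fps_subst_fps1 ?var_coef0 //.
  by rewrite -!/(fps2 _ g h) fps2_var0.
have Fx0 k (g : fps k R) : g 0%MM = 0 -> fps2 F 0 g = g.
  move=> g0; have g0' := nilpotent1 g0.
  have := congr1 (fun f => fps_subst f [tuple g]) F0t.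
  rewrite /= fps_subst_fps2 ?fps_coef0 ?var_coef0 //.
  by rewrite fps_subst0 // -!/(fps1 _ g) fps1_var.
have neq (i j : nat) : (i < 3)%N -> (j < 3)%N -> i != j ->
    (inord i == inord j :> 'I_3) = false.
  move=> lt_i lt_j ij; apply/eqP => /(congr1 val).
  by rewrite /= !inordK // => /eqP; rewrite (negbTE ij).
have dx : fps_deriv (inord 0) x = 1 by rewrite fps_derivV eqxx.
have dy : fps_deriv (inord 0) y = 0 by rewrite fps_derivV neq.
have dz : fps_deriv (inord 0) z = 0 by rewrite fps_derivV neq.
set A := fps2 F _ z; set B := fps2 F x _.
(* By the chain rule, the invariance of the differential is applied twice: from [x] to [F(x, y)],
   then from there to [A]. *)
have dA : fps1 p x * fps_deriv (inord 0) A = fps1 p A.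
  rewrite fps_deriv2 // fps_deriv2 // dx dy dz !mulr0 !addr0 mulr1.
  by rewrite mulrCA dFsubst // mulrC dFsubst.
have dB : fps1 p x * fps_deriv (inord 0) B = fps1 p B.
  rewrite fps_deriv2 // fps_deriv2 // dx dy dz !(mulr0, addr0) mulr1.
  by rewrite dFsubst.
(* The difference quotient makes the equation for [A - B] linear: [p(x) d(A - B)/dx = p(A) - p(B) =
   (A - B) K(A, B)]. *)
have defK := fps_diff_quotientE p; set K := fps_diff_quotient p in defK.
have A0 : A 0%MM = 0 by apply: F00.
have B0 : B 0%MM = 0 by apply: F00.
have AB0 := nilpotent2 A0 B0.
have pAB : fps1 p A - fps1 p B = (A - B) * fps2 K A B.
  have := congr1 (fun f => fps_subst f [tuple A; B]) defK.
  rewrite /= fps_substB fps_substM // fps_substB.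
  by rewrite !fps_subst_fps1 ?var_coef0 // -!/(fps2 _ A B) fps2_var0 ?fps2_var1.
have px : fps1 p x \is a GRing.unit by apply: fps_unit1; rewrite fps1_coef0.
apply/eqP; rewrite -subr_eq0; apply/eqP.
apply: (@fps_ode_eq0 _ _ (inord 0) _ ((fps1 p x)^-1 * fps2 K A B)) => // [|m m0].
  apply: (mulrI px); rewrite fps_derivB mulrBr dA dB pAB -mulrA mulVKr //.
  exact: mulrC.
(* The initial value is computed by setting [x = 0], where the unit axiom turns both [A] and [B]
   into [F(y, z)]. *)
pose s : 3.-tuple (fps 3 R) := [tuple 0; y; z].
have sE j : tnth s j = if j == inord 0 then 0 else fps_var j.
  case: j => [[|[|[]]]] // lt_j.
  - by case: eqP => // - []; apply: val_inj; rewrite /= inordK.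
  - case: eqP => [/(congr1 val)|_]; first by rewrite /= inordK.
    by rewrite (tnth_nth 0) /=; congr fps_var; apply: val_inj; rewrite /= inordK.
  - case: eqP => [/(congr1 val)|_]; first by rewrite /= inordK.
    by rewrite (tnth_nth 0) /=; congr fps_var; apply: val_inj; rewrite /= inordK.
have s0 : nilpotent_subst s.
  by move=> j; rewrite sE; case: ifP => _; [exact: fps_coef0 | exact: fps_var_coef0].
have <- : fps_subst (A - B) s m = (A - B) m.
  by apply: fps_subst_restr m0 => [|j /negbTE j0]; rewrite sE ?eqxx ?j0.
have sx : fps_subst x s = 0 by rewrite fps_substV // sE eqxx.
have sy : fps_subst y s = y by rewrite fps_substV // sE neq.
have sz : fps_subst z s = z by rewrite fps_substV // sE neq.
by rewrite fps_substB !fps_subst_fps2 // sx sy sz !Fx0 // subrr fps_coef0.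
Qed.

(** * The chord law *)

(** The relation [(p dF/du)^2 = Q(F)] cleared of denominators. Here [p] and [q] are the roots at [u]
    and [v], [h = d H], [M = d^2 S^2], [B = - p dp/du], and [G] is [d^3 S^3 p dF/du] for
    [F = s / S]; both sides carry the factor [d^6 S^6]. *)
Lemma chord_law_identity (K : comNzRingType) (u v p q a1 a2 a3 : K)
    (d := u - v) (s := u + v) (h := u * q - v * p)
    (M := h ^+ 2 + a3 * u ^+ 2 * v ^+ 2 * s ^+ 2 * d ^+ 2)
    (B := a1 * u - 2%:R * a2 * u ^+ 3 + 3%:R * a3 * u ^+ 5)
    (G := d * p * M - s * (h * (d * p * q + d * v * B - p * h) +
            d ^+ 3 * a3 * v ^+ 2 * p * (u * s ^+ 2 + u ^+ 2 * s))) :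
    p ^+ 2 = 1 - a1 * u ^+ 2 + a2 * u ^+ 4 - a3 * u ^+ 6 ->
    q ^+ 2 = 1 - a1 * v ^+ 2 + a2 * v ^+ 4 - a3 * v ^+ 6 ->
  G ^+ 2 = M ^+ 3 - a1 * s ^+ 2 * d ^+ 2 * M ^+ 2 + a2 * s ^+ 4 * d ^+ 4 * M
     - a3 * s ^+ 6 * d ^+ 6.
Proof. by move=> hp hq; rewrite /G /B /M /h /s /d; ring: hp hq. Qed.

(** Primes stand for derivatives in [u], with [v] and [q] constant. The last four hypotheses are the
    derivatives of the equations for [p ^+ 2], [d * H], [S ^+ 2] and [F * S]; together they identify
    [d^3 S^3 p F'] with the [G] of [chord_law_identity]. *)
Lemma chord_law_derivative (K : comNzRingType)
    (c u v p q a1 a2 a3 H S F p' H' S' F' : K) (d := u - v) (s := u + v) :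
    2%:R * c = 1 ->
    p ^+ 2 = 1 - a1 * u ^+ 2 + a2 * u ^+ 4 - a3 * u ^+ 6 ->
    q ^+ 2 = 1 - a1 * v ^+ 2 + a2 * v ^+ 4 - a3 * v ^+ 6 ->
    d * H = u * q - v * p ->
    S ^+ 2 = H ^+ 2 + a3 * u ^+ 2 * v ^+ 2 * s ^+ 2 ->
    F * S = s ->
    2%:R * p * p' = - (2%:R * a1 * u) + 4%:R * a2 * u ^+ 3 - 6%:R * a3 * u ^+ 5 ->
    H + d * H' = q - v * p' ->
    2%:R * S * S' = 2%:R * H * H' +
      2%:R * a3 * v ^+ 2 * (u * s ^+ 2 + u ^+ 2 * s) ->
    F' * S + F * S' = 1 ->
  d ^+ 6 * (S ^+ 6 * (p * F') ^+ 2) =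
  d ^+ 6 * (S ^+ 6 * (1 - a1 * F ^+ 2 + a2 * F ^+ 4 - a3 * F ^+ 6)).
Proof.
move=> c2 hp hq hH hS hF e1 e2 e3 e4.
have sub0 (x y : K) : x = y -> x - y = 0 by move=> ->; apply: subrr.
move/sub0: e1 => E1; move/sub0: e2 => E2; move/sub0: e3 => E3; move/sub0: e4 => E4.
have E5 : F * S - s = 0 by rewrite hF subrr.
have := chord_law_identity hp hq; rewrite -/d -/s -hH.
set M := (d * H) ^+ 2 + _; have {M} -> : M = d ^+ 2 * S ^+ 2 by rewrite /M hS; ring.
set G := d * p * _ - _ => defG2.
(* The remaining identities hold with [d] and [s] as independent variables. *)
clearbody d s.
have defG : d ^+ 3 * p * F' * S ^+ 3 = G.
  (* Derivatives of squares carry a factor 2, so it is twice the difference that is a combination of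
     the five vanishing expressions [E1] to [E5]; the factor [c] undoes the doubling. *)
  apply/subr0_eq; rewrite -[LHS]mul1r -c2 [2%:R * c]mulrC -[c * 2%:R * _]mulrA.
  set X := 2%:R * (_ - _); have {X} -> : X =
      2%:R * d ^+ 3 * p * S ^+ 2 * (F' * S + F * S' - 1)
      - 2%:R * d ^+ 3 * p * S * S' * (F * S - s)
      - d ^+ 3 * p * s * (2%:R * S * S' - (2%:R * H * H' +
          2%:R * a3 * v ^+ 2 * (u * s ^+ 2 + u ^+ 2 * s)))
      - 2%:R * s * d ^+ 2 * H * p * (H + d * H' - (q - v * p'))
      + s * d ^+ 2 * H * v * (2%:R * p * p' - (- (2%:R * a1 * u) +
          4%:R * a2 * u ^+ 3 - 6%:R * a3 * u ^+ 5)).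
    by rewrite /X /G; ring.
  by rewrite E1 E2 E3 E4 E5; ring.
transitivity ((d ^+ 3 * p * F' * S ^+ 3) ^+ 2); first by ring.
by rewrite defG defG2 -hF; ring.
Qed.

(** * The invariant differential of the chord law and the group law axioms *)

Section InvariantDifferential.
Variables (R : comNzRingType) (half : R).
Hypothesis halfP : 2%:R * half = 1.
Variables (a1 a2 a3 : R).

Definition bc_poly k (g : fps k R) : fps k R :=
  1 - fps_const a1 * g ^+ 2 + fps_const a2 * g ^+ 4 - fps_const a3 * g ^+ 6.

Local Notation Q := (bc_poly (var 0 R 0)).
Local Notation sqrtQ := (fps1 (fps_sqrt Q)).

Lemma fps_subst_bc_poly k l (s : k.-tuple (fps l R)) (g : fps k R) :
  nilpotent_subst s -> fps_subst (bc_poly g) s = bc_poly (fps_subst g s).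
Proof.
move=> s0; rewrite /bc_poly fps_substB fps_substD fps_substB.
rewrite !(fps_substM s0 (fps_const _)).
by rewrite !fps_substX // !fps_substC // fps_subst1.
Qed.

Lemma bc_poly_coef0 k (g : fps k R) : g 0%MM = 0 -> bc_poly g 0%MM = 1.
Proof.
move=> g0; rewrite !(fps_coefB, fps_coefD) !fps_coefCM !exprS !fps_coef0M g0.
by rewrite !(mul0r, mulr0, subr0, addr0) fps_coef1 eqxx.
Qed.

Let Q0 : Q 0%MM = 1. Proof. exact/bc_poly_coef0/var_coef0. Qed.

Lemma sqrtQ_coef0 k (g : fps k R) : sqrtQ g 0%MM = 1.
Proof. by rewrite fps1_coef0; case: (fps_sqrtP halfP Q0). Qed.

Lemma sqrtQ_sqr k (g : fps k R) : g 0%MM = 0 -> sqrtQ g ^+ 2 = bc_poly g.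
Proof.
move=> g0; have g0' := nilpotent1 g0.
rewrite /fps1 -fps_substX //; have [_ ->] := fps_sqrtP halfP Q0.
exact: etrans (fps_subst_bc_poly _ g0') (congr1 (@bc_poly k) (fps1_var g0)).
Qed.

Lemma sqrtQ_unique k (f g : fps k R) :
  g 0%MM = 0 -> f 0%MM = 1 -> f ^+ 2 = bc_poly g -> f = sqrtQ g.
Proof.
move=> g0 f0 fg; apply: (fps_sqr_inj halfP) => //; first exact: sqrtQ_coef0.
by rewrite sqrtQ_sqr.
Qed.

Lemma sqrtQ0 k : sqrtQ (0 : fps k R) = 1.
Proof.
apply/esym/sqrtQ_unique; rewrite ?fps_coef0 ?fps_coef1 ?eqxx // expr1n.
by rewrite /bc_poly !expr0n !mulr0 !(subr0, addr0).
Qed.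

Local Notation u := (var 1 R 0).
Local Notation v := (var 1 R 1).

Variables H S F : fps 2 R.
Hypothesis defH : (u - v) * H = u * sqrtQ v - v * sqrtQ u.
Hypothesis defS :
  S ^+ 2 = H ^+ 2 + fps_const a3 * u ^+ 2 * v ^+ 2 * (u + v) ^+ 2.
Hypothesis S0 : S 0%MM = 1.
Hypothesis defF : F * S = u + v.

Let u0 : u 0%MM = 0. Proof. exact: var_coef0. Qed.
Let v0 : v 0%MM = 0. Proof. exact: var_coef0. Qed.

Let F0 : F 0%MM = 0.
Proof.
have := congr1 (fun f : fps 2 R => f 0%MM) defF.
by rewrite fps_coef0M S0 mulr1 fps_coefD u0 v0 addr0.
Qed.

(** Both sides have constant term 1, so comparing squares is enough. The squares agree after
    multiplication by [S ^+ 6], a unit, and by [(u - v) ^+ 6], a non-zero-divisor. *)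
Lemma chord_invariant_differential :
  sqrtQ u * fps_deriv (inord 0) F = sqrtQ F.
Proof.
pose D := @fps_deriv 2 R (inord 0).
have Du : D u = 1 by rewrite /D fps_derivV eqxx.
have Dv : D v = 0 by rewrite /D fps_derivV ord2_neq.
have Dc (c : R) : D (fps_const c) = 0 by apply: fps_derivC.
have DX f e : D (f ^+ e.+1) = e.+1%:R * f ^+ e * D f.
  elim: e => [|e IHe]; first by rewrite !expr1 expr0 mulr1 mul1r.
  by rewrite exprS /D fps_derivM -/D IHe [e.+2%:R]mulrS !exprS; ring.
have Dq : D (sqrtQ v) = 0.
  rewrite /D fps_deriv_subst; last exact: nilpotent1.
  by rewrite big_ord1 (tnth_nth 0) /= -/D Dv mulr0.
have Dbc : D (bc_poly u) = - (2%:R * fps_const a1 * u) +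
    4%:R * fps_const a2 * u ^+ 3 - 6%:R * fps_const a3 * u ^+ 5.
  rewrite /bc_poly /D fps_derivB fps_derivD fps_derivB.
  rewrite !(fps_derivM _ (fps_const _)) -/D !DX Du !Dc.
  by rewrite expr1; ring.
have p0 := sqrtQ_coef0 u.
have hp := sqrtQ_sqr u0; have hq := sqrtQ_sqr v0.
have dH := defH.
suff FE : (sqrtQ u * D F) ^+ 2 = bc_poly F /\ (sqrtQ u * D F) 0%MM = 1.
  by case: FE => FE2 FE0; apply: sqrtQ_unique FE2.
(* The roots become arbitrary series [p] and [q], known only by their squares, the equation of [H],
   the constant term of [p] and the independence of [q] from [u]. *)
move: (sqrtQ u) (sqrtQ v) p0 hp hq dH Dq => p q p0 hp hq dH Dq.
have SU := fps_unit1 S0.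
have e1 := congr1 D hp; rewrite Dbc DX expr1 in e1.
have e2 : H + (u - v) * D H = q - v * D p.
  have := congr1 D dH; rewrite /D fps_derivM !fps_derivB !fps_derivM -/D Du Dv Dq.
  by rewrite subr0 !mul1r mul0r mulr0 add0r addr0.
have e3 : 2%:R * S * D S = 2%:R * H * D H +
    2%:R * fps_const a3 * v ^+ 2 * (u * (u + v) ^+ 2 + u ^+ 2 * (u + v)).
  have := congr1 D defS; rewrite DX expr1 => ->.
  rewrite /D fps_derivD !(fps_derivM _ (_ * _)) (fps_derivM _ (fps_const _)) -/D.
  by rewrite !DX /D fps_derivD -/D Du Dv Dc !expr1; ring.
have e4 : D F * S + F * D S = 1.
  by rewrite /D -fps_derivM defF fps_derivD -/D Du Dv addr0.
split.
  apply: (mulrI (unitrX 6 SU)).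
  have regX k (f g : fps 2 R) : (u - v) ^+ k * f = (u - v) ^+ k * g -> f = g.
    elim: k f g => [|k IHk] f g; first by rewrite expr0 !mul1r.
    by rewrite exprSr -!mulrA => /IHk /(fps_varB_inj (negbT ord2_neq)).
  apply: (regX 6%N).
  apply: (chord_law_derivative (c := fps_const half) _ hp hq dH defS defF e1 e2 e3 e4).
  by rewrite -(rmorph_nat (@fps_const 2 R)) -rmorphM halfP rmorph1.
(* At the origin [S = 1] and [F = 0], so [e4] gives [dF/du = 1] there. *)
have := congr1 (fun f : fps 2 R => f 0%MM) e4.
rewrite fps_coefD !fps_coef0M S0 F0 mul0r addr0 mulr1 fps_coef1 eqxx => FE.
by rewrite FE mulr1; apply: p0.
Qed.

(** The equations determine [H], then [S], then [F], because [u - v] is not a zero divisor, square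
    roots are unique and [S] is a unit. Substituting into them yields the unit laws and
    commutativity; associativity comes from the invariant differential. *)
Lemma chord_law_is_fgl :
  (forall d (x : R), x *+ d.+1 = 0 -> x = 0) -> is_fgl F.
Proof.
move=> torsion_free.
pose t := var 0 R 0; have t0 : t 0%MM = 0 by apply: var_coef0.
have z0 : (0 : fps 1 R) 0%MM = 0 by apply: fps_coef0.
have sub k (g h : fps k R) : g 0%MM = 0 -> h 0%MM = 0 ->
    [/\ (g - h) * fps2 H g h = g * sqrtQ h - h * sqrtQ g,
        fps2 S g h ^+ 2 =
          fps2 H g h ^+ 2 + fps_const a3 * g ^+ 2 * h ^+ 2 * (g + h) ^+ 2,
        fps2 S g h 0%MM = 1 & fps2 F g h * fps2 S g h = g + h].
  move=> g0 h0; have gh0 := nilpotent2 g0 h0.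
  split; last 2 first.
  - by rewrite fps2_coef0.
  - by rewrite /fps2 -fps_substM // defF fps_substD -!/(fps2 _ g h)
      fps2_var0 ?fps2_var1.
  - have := congr1 (fun f => fps_subst f [tuple g; h]) defH.
    rewrite /= fps_substB !fps_substM // fps_substB !fps_subst_fps1 //.
    by rewrite -!/(fps2 _ g h) fps2_var0 ?fps2_var1.
  - rewrite /fps2 -fps_substX // defS fps_substD.
    rewrite !(fps_substM gh0 (_ * _)) (fps_substM gh0 (fps_const _)).
    rewrite !fps_substX // fps_substC // fps_substD.
    by rewrite -!/(fps2 _ g h) fps2_var0 ?fps2_var1.
have sqr1 (f : fps 1 R) : f 0%MM = 1 -> f ^+ 2 = 1 -> f = 1.
  by move=> f0 f2; apply: (fps_sqr_inj halfP) => //; rewrite ?fps_coef1 ?eqxx ?expr1n.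
have Ft0 : fps2 F t 0 = t.
  have [dH dS Sc dF] := sub _ t 0 t0 z0.
  have H1 : fps2 H t 0 = 1.
    by move: dH; rewrite subr0 sqrtQ0 mul0r subr0; apply: fps_varM_inj.
  have S1 : fps2 S t 0 = 1 by apply: sqr1 => //; rewrite dS H1; ring.
  by rewrite -[LHS]mulr1 -S1 dF addr0.
have F0t : fps2 F 0 t = t.
  have [dH dS Sc dF] := sub _ 0 t z0 t0.
  have H1 : fps2 H 0 t = 1.
    by move: dH; rewrite sub0r mul0r sub0r sqrtQ0 mulNr => /oppr_inj;
      apply: fps_varM_inj.
  have S1 : fps2 S 0 t = 1 by apply: sqr1 => //; rewrite dS H1; ring.
  by rewrite -[LHS]mulr1 -S1 dF add0r.
split=> //.
- have [dH dS Sc dF] := sub _ v u v0 u0.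
  (* Exchanging [u] and [v] changes the sign of both sides of [defH], so [H] is symmetric. *)
  have H1 : fps2 H v u = H.
    apply: (fps_varB_inj (negbT ord2_neq)); apply: etrans (esym defH).
    transitivity (- ((v - u) * fps2 H v u)); first by rewrite -mulNr opprB.
    exact: etrans (congr1 -%R dH) (opprB _ _).
  have S1 : fps2 S v u = S.
    by apply: (fps_sqr_inj halfP) => //; rewrite dS H1 defS; ring.
  by apply: (mulIr (fps_unit1 S0)); rewrite -{1}S1 dF defF addrC.
- apply: (@fps_assoc_of_invariant_differential _ _ (fps_sqrt Q)) => //.
    by case: (fps_sqrtP halfP Q0).
  exact: chord_invariant_differential.
Qed.

End InvariantDifferential.

(** * Homogeneity *)

(** From [u p(v) - v p(u) = (u - v) p(u) - u (p(u) - p(v))]. This shows that the division defining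
    [H_Bc] is exact and gives its value explicitly. *)
Lemma chord_quotient_exists (R : comNzRingType) (p : fps 1 R)
    (u := var 1 R 0) (v := var 1 R 1) :
  (u - v) * (fps1 p u - u * fps_diff_quotient p) = u * fps1 p v - v * fps1 p u.
Proof.
rewrite mulrBr [X in _ - X]mulrCA -fps_diff_quotientE -/u -/v.
by move: (fps1 p u) (fps1 p v) => x y; ring.
Qed.

Lemma chord_quotient_coef0 (R : comNzRingType) (p : fps 1 R) (H : fps 2 R)
    (u := var 1 R 0) (v := var 1 R 1) :
  p 0%MM = 1 -> (u - v) * H = u * fps1 p v - v * fps1 p u -> H 0%MM = 1.
Proof.
move=> p0; rewrite -chord_quotient_exists => /(fps_varB_inj (negbT ord2_neq)) ->.
by rewrite fps_coefB fps_coef0M var_coef0 mul0r subr0 fps1_coef0.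
Qed.

Section Homogeneity.
Variables (R : comNzRingType) (G : int -> R -> Prop).
Hypothesis G0 : forall d, G d 0.
Hypothesis G1 : G 0 1.
Hypothesis GN : forall d x, G d x -> G d (- x).
Hypothesis GD : forall d x y, G d x -> G d y -> G d (x + y).
Hypothesis GM : forall d e x y, G d x -> G e y -> G (d + e) (x * y).

(** [G d] stands for the elements of degree [d] in the coefficient ring. Each variable has degree 2,
    so the coefficient at [m] must make up the remaining [w - 2 mdeg m]. *)
Definition fps_homog k (w : int) (f : fps k R) :=
  forall m, G (w - (2 * mdeg m)%N%:Z) (f m).

Section Closure.
Variable k : nat.
Implicit Types (f g : fps k R).

Lemma fps_homogD w f g : fps_homog w f -> fps_homog w g -> fps_homog w (f + g).
Proof. by move=> fw gw m; apply: GD. Qed.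

Lemma fps_homogN w f : fps_homog w f -> fps_homog w (- f).
Proof. by move=> fw m; apply: GN. Qed.

Lemma fps_homogB w f g : fps_homog w f -> fps_homog w g -> fps_homog w (f - g).
Proof. by move=> fw gw; apply/fps_homogD/fps_homogN. Qed.

Lemma fps_homogM w x f g :
  fps_homog w f -> fps_homog x g -> fps_homog (w + x) (f * g).
Proof.
move=> fw gx m; rewrite /= ; apply: big_ind => // [|p /eqP def_m].
  by move=> a b; apply: GD.
rewrite (_ : _ - _ = w - (2 * mdeg p.1)%N%:Z + (x - (2 * mdeg p.2)%N%:Z)).
  exact: GM.
by have := congr1 mdeg def_m; rewrite mdegD; lia.
Qed.

Lemma fps_homogC w c : G w c -> fps_homog w (fps_const c : fps k R).
Proof.
move=> Gc m /=; case: eqP => [->|_]; last exact: G0.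
by rewrite mdeg0 muln0 subr0.
Qed.

Lemma fps_homog1 : fps_homog 0 (1 : fps k R).
Proof. exact: fps_homogC. Qed.

Lemma fps_homogX w f e : fps_homog w f -> fps_homog (w *+ e) (f ^+ e).
Proof.
move=> fw; elim: e => [|e IHe]; first exact: fps_homog1.
by rewrite exprS mulrS; apply: fps_homogM.
Qed.

Lemma fps_homogV (i : 'I_k) : fps_homog 2%:Z (fps_var i : fps k R).
Proof.
by move=> m /=; case: eqP => [->|_]; [rewrite mdeg1 subrr | apply: G0].
Qed.

Lemma fps_homog_inv f : f 0%MM = 1 -> fps_homog 0 f -> fps_homog 0 f^-1.
Proof.
move=> f0 fH; suff [] : f \is a GRing.unit /\ fps_homog 0 f^-1 by [].
apply: (@fps_inv_ind _ _ (fun m => G (0 - (2 * mdeg m)%N%:Z))) => // g gH.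
apply/fps_homogD; first exact: fps_homog1.
by rewrite -[0]addr0; apply/fps_homogM/gH/fps_homogB/fH/fps_homog1.
Qed.

Lemma fps_homog_sqrt half f : 2%:R * half = 1 -> G 0 half -> f 0%MM = 1 ->
  fps_homog 0 f -> fps_homog 0 (fps_sqrt f).
Proof.
move=> halfP Gh f0 fH.
have [||g [g0 g2 gH]] := @fps_sqrt_ind k R half halfP
    (fun m => G (0 - (2 * mdeg m)%N%:Z)) f f0 => //.
  move=> g gH; rewrite -[0]addr0; apply: fps_homogM; first exact: fps_homogC.
  apply: fps_homogB; first exact: fps_homogB fH fps_homog1.
  apply: (@fps_homogX 0 _ 2); apply: fps_homogB => //; apply: fps_homogC.
  by have := gH 0%MM; rewrite mdeg0 muln0 subr0.
have [s0 s2] := fps_sqrtP halfP f0.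
rewrite (_ : fps_sqrt f = 1 + g); first exact: fps_homogD fps_homog1 gH.
apply: (fps_sqr_inj halfP) => //; last by rewrite s2 g2.
by rewrite fps_coefD g0 addr0 fps_coef1 eqxx.
Qed.

Lemma fps_homog_fps1_var w (p : fps 1 R) (i : 'I_k) :
  fps_homog w p -> fps_homog w (fps1 p (fps_var i)).
Proof.
move=> pw m; rewrite fps1_varE; case: eqP => [_|_]; last exact: G0.
by have := pw (U_(ord0) *+ mdeg m)%MM; rewrite mdegMn mdeg1 mul1n.
Qed.

End Closure.

Lemma fps_homog_diff_quotient w (p : fps 1 R) :
  fps_homog w p -> fps_homog (w - 2%:Z) (fps_diff_quotient p).
Proof.
move=> pw m; have := pw (U_(ord0) *+ (mdeg m).+1)%MM.
rewrite mdegMn mdeg1 mul1n /=; congr (G _ _); lia.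
Qed.

Section ChordLaw.
Variables (half a1 a2 a3 : R).
Hypothesis halfP : 2%:R * half = 1.
Hypotheses (Ghalf : G 0 half) (Ga1 : G (- 4%:Z) a1) (Ga2 : G (- 8%:Z) a2).
Hypothesis Ga3 : G (- 12%:Z) a3.

Local Notation u := (var 1 R 0).
Local Notation v := (var 1 R 1).
Local Notation Q := (bc_poly a1 a2 a3 (var 0 R 0)).
Local Notation sqrtQ := (fps1 (fps_sqrt Q)).

Lemma chord_law_homog (H : fps 2 R) :
    H 0%MM = 1 ->
    (u - v) * H = u * sqrtQ v - v * sqrtQ u ->
  fps_homog 2%:Z ((u + v) /
    fps_sqrt (H ^+ 2 + fps_const a3 * u ^+ 2 * v ^+ 2 * (u + v) ^+ 2)).
Proof.
move=> H0 defH.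
have uH : fps_homog 2%:Z u by apply: fps_homogV.
have vH : fps_homog 2%:Z v by apply: fps_homogV.
have QH : fps_homog 0 Q.
  have tH : fps_homog 2%:Z (var 0 R 0) by apply: fps_homogV.
  have tX c e : G (- (2%:Z *+ e)) c -> fps_homog 0 (fps_const c * var 0 R 0 ^+ e).
    move=> Gc; rewrite -(addNr (2%:Z *+ e)); apply: fps_homogM; first exact: fps_homogC.
    exact: fps_homogX.
  apply: fps_homogB; last exact: (tX _ 6%N).
  apply: fps_homogD; last exact: (tX _ 4%N).
  by apply: fps_homogB; [exact: fps_homog1 | exact: (tX _ 2%N)].
have rH : fps_homog 0 (fps_sqrt Q).
  by apply: (fps_homog_sqrt halfP) => //; apply/bc_poly_coef0/var_coef0.
have HH : fps_homog 0 H.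
  (* In this form no division by [u - v] is left: the difference quotient lowers the weight by 2 and
     the factor [u] restores it. *)
  have -> : H = sqrtQ u - u * fps_diff_quotient (fps_sqrt Q).
    by apply: (fps_varB_inj (negbT ord2_neq)); apply: etrans defH _;
      apply/esym/chord_quotient_exists.
  apply: fps_homogB; first exact: fps_homog_fps1_var.
  by rewrite -(addrN 2%:Z) -[- 2%:Z]add0r; apply/fps_homogM/fps_homog_diff_quotient.
have NH : fps_homog 0
    (H ^+ 2 + fps_const a3 * u ^+ 2 * v ^+ 2 * (u + v) ^+ 2).
  apply: fps_homogD; first exact: (@fps_homogX _ 0 _ 2).
  (* The degree -12 of [a3] balances six factors of degree 2. *)
  rewrite (_ : 0 = - 12%:Z + 2%:Z *+ 2 + 2%:Z *+ 2 + 2%:Z *+ 2) //.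
  apply: fps_homogM; last exact/fps_homogX/fps_homogD.
  by do 2!(apply: fps_homogM; last exact: fps_homogX); apply: fps_homogC.
have N0 : (H ^+ 2 + fps_const a3 * u ^+ 2 * v ^+ 2 * (u + v) ^+ 2) 0%MM = 1.
  rewrite fps_coefD !fps_coef0M H0 fps_coefD !var_coef0 addr0 !(mul0r, mulr0).
  by rewrite mulr1 addr0.
rewrite -[2%:Z]addr0; apply: fps_homogM; first exact: fps_homogD.
apply: fps_homog_inv; first by case: (fps_sqrtP halfP N0).
exact: (fps_homog_sqrt halfP).
Qed.

End ChordLaw.
End Homogeneity.

(** * The Lazard ring *)

(** The unit axioms fix the coefficients of pure powers of [u] or [v]. Only the mixed ones are free,
    and these are the images of the Lazard generators. *)
Lemma fgl_coef (R : comNzRingType) (F : fps 2 R) (m : 'X_{1..2}) :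
    is_fgl F -> m (inord 0) = 0%N \/ m (inord 1) = 0%N ->
  F m = (m == U_(inord 0))%MM%:R + (m == U_(inord 1))%MM%:R.
Proof.
case=> Ft0 F0t _ _.
have z0 k : (0 : fps k R) 0%MM = 0 by apply: fps_coef0.
have lift_unit (g : fps 2 R) : g 0%MM = 0 -> fps2 F g 0 = g /\ fps2 F 0 g = g.
  move=> g0; have g0' := nilpotent1 g0.
  have := congr1 (fun f => fps_subst f [tuple g]) Ft0.
  have := congr1 (fun f => fps_subst f [tuple g]) F0t.
  rewrite /= !fps_subst_fps2 ?var_coef0 // !fps_subst0 //.
  by rewrite -!/(fps1 _ g) fps1_var.
case=> m0.
  have [_ Fv] := lift_unit _ (var_coef0 R 1 1).
  rewrite -(@fps_subst_restr _ _ (inord 0) [tuple 0; var 1 R 1] F m) ?tnth_pair0 //.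
    rewrite -/(fps2 F 0 _) Fv /= [in X in X + _](_ : _ == _ = false) ?add0r //.
    by apply/eqP => Em; move: m0; rewrite Em mnm1E eqxx.
  by move=> j; have [->|->] := ord2E j; rewrite ?eqxx // tnth_pair1.
have [Fu _] := lift_unit _ (var_coef0 R 1 0).
rewrite -(@fps_subst_restr _ _ (inord 1) [tuple var 1 R 0; 0] F m) ?tnth_pair1 //.
  rewrite -/(fps2 F _ 0) Fu /= [in X in _ + X](_ : _ == _ = false) ?addr0 //.
  by apply/eqP => Em; move: m0; rewrite Em mnm1E eqxx.
by move=> j; have [->|->] := ord2E j; rewrite ?eqxx // tnth_pair0.
Qed.

(** * Monomials in the Lazard generators and their evaluation *)

Section CommutativeMonomials.
Local Notation cmonom := (monalg.cmonom lazard_index).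
Implicit Types (m : cmonom).

Lemma cmonom_ind (P : cmonom -> Prop) :
    P (@monalg.one _) ->
    (forall i m, P m -> P (monalg.mul (monalg.ucm i) m)) ->
  forall m, P m.
Proof.
move=> P1 PU m; have [d] := ubnP (monalg.mdeg m).
elim: d m => // d IHd m /ltnSE-le_md.
have [->//|] := eqVneq m (@monalg.one _).
rewrite -monalg.mdeg_eq0 monalg.mdegE.
have [->|[i im] _] := fset_0Vmem (finsupp m); first by rewrite big_seq_fset0.
have def_m : m = monalg.mul (monalg.ucm i) (monalg.divcm m (monalg.ucm i)).
  apply/eqP/monalg.cmP => j; rewrite monalg.cmM monalg.cmU monalg.divcmE monalg.ucmE.
  by have [<-|] := eqVneq i j; rewrite ?add0n ?subn0 // subnKC // lt0n monalg.cmE_neq0.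
rewrite def_m; apply: PU; apply: IHd.
by move: le_md; rewrite [in X in X -> _]def_m monalg.mdegM monalg.mdegU.
Qed.

Lemma lazard_degM m1 m2 :
  lazard_deg (monalg.mul m1 m2) = lazard_deg m1 + lazard_deg m2.
Proof.
rewrite /lazard_deg -opprD -PoszD; congr (- Posz _).
pose w (k : lazard_index) := (2 * (k.1.+1 + k.2.+1 - 1))%N.
have E m (d : {fset lazard_index}) : (finsupp m `<=` d)%fset ->
    (\sum_(k <- finsupp m) m k * w k = \sum_(k <- d) m k * w k)%N.
  move=> md; apply: big_fset_incl => // k _.
  by rewrite -monalg.cmE_eq0 => /eqP->.
rewrite monalg.mdomD (E m1 (finsupp m1 `|` finsupp m2)%fset) ?fsubsetUl //.
rewrite (E m2 (finsupp m1 `|` finsupp m2)%fset) ?fsubsetUr // -big_split /=.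
by apply: eq_bigr => k _; rewrite monalg.cmM mulnDl.
Qed.

Lemma lazard_degU i j : lazard_deg (monalg.ucm (i, j)) = - (2 * (i + j).+1)%N%:Z.
Proof.
rewrite /lazard_deg monalg.mdomU big_seq_fset1 monalg.cmU eqxx mul1n /=.
by congr (- Posz _); lia.
Qed.

Lemma lazard_deg1 : lazard_deg (@monalg.one _) = 0.
Proof. by rewrite /lazard_deg monalg.mdom1 big_seq_fset0 oppr0. Qed.

Variables (R : comNzRingType) (c : lazard_index -> R).

Definition cmonom_eval m : R := \prod_(k <- finsupp m) c k ^+ m k.

Lemma cmonom_eval_mmorphism : monalg.mmorphism cmonom_eval.
Proof.
split=> [m1 m2|]; last by rewrite /cmonom_eval monalg.mdom1 big_seq_fset0.
have E m (d : {fset lazard_index}) : (finsupp m `<=` d)%fset ->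
    cmonom_eval m = \prod_(k <- d) c k ^+ m k.
  move=> md; apply: big_fset_incl => // k _.
  by rewrite -monalg.cmE_eq0 => /eqP->; rewrite expr0.
rewrite (E (monalg.mul m1 m2) (finsupp m1 `|` finsupp m2)%fset) ?monalg.mdomD //.
rewrite (E m1 (finsupp m1 `|` finsupp m2)%fset) ?fsubsetUl //.
rewrite (E m2 (finsupp m1 `|` finsupp m2)%fset) ?fsubsetUr // -big_split /=.
by apply: eq_bigr => k _; rewrite monalg.cmM exprD.
Qed.

Definition cmonom_morphism : monalg.MMorphism.type cmonom R :=
  monalg.MMorphism.Pack (monalg.MMorphism.Class
    (monalg.isMultiplicative.phant_Build cmonom_eval_mmorphism)).

(** The universal property of the polynomial ring on the [c_ij]: any choice of values extends to a
    ring morphism. *)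
Definition lazard_eval : {rmorphism lazard_poly -> R} :=
  (monalg.mmap (intr : {rmorphism int -> R})
     (monalg.MMorphism.sort cmonom_morphism) : lazard_poly -> R).

Lemma lazard_evalU i j : lazard_eval (lazard_gen i j) = c (i, j).
Proof.
rewrite /= /lazard_gen monalg.mmapU /= mulr1z mul1r /cmonom_eval.
by rewrite monalg.mdomU big_seq_fset1 monalg.cmU eqxx expr1.
Qed.

End CommutativeMonomials.

Section LazardMorphisms.
Variables (R : comNzRingType).
Implicit Types (f g : {rmorphism lazard_poly -> R}) (p : lazard_poly).

Definition lazard_mon (m : monalg.cmonom lazard_index) : lazard_poly :=
  monalg.mkmalgU m 1.

Lemma lazard_monM m1 m2 :
  lazard_mon (monalg.mul m1 m2) = lazard_mon m1 * lazard_mon m2.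
Proof. by rewrite /lazard_mon [RHS]monalg.malgM_def monalg.fgmulUU mulr1. Qed.

Lemma lazard_polyE p f :
  f p = \sum_(m <- monalg.msupp p) (monalg.mcoeff m p)%:~R * f (lazard_mon m).
Proof.
rewrite {1}[p]monalg.monalgE rmorph_sum /=; apply: eq_bigr => m _.
rewrite -(rmorph_int f) -rmorphM; congr (f _).
by rewrite mulrzl /lazard_mon -(raddfMz (monalg.mkmalgU m)) intz.
Qed.

(** A polynomial is an integer combination of monomials, and ring morphisms have no choice on
    integers; on monomials they are fixed by the generators. *)
Lemma lazard_ext f g :
  (forall i j, f (lazard_gen i j) = g (lazard_gen i j)) -> f =1 g.
Proof.
move=> fg p; rewrite !lazard_polyE; apply: eq_bigr => m _; congr (_ * _).
elim/cmonom_ind: m => [|[i j] m IHm]; first by rewrite !rmorph1.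
have -> : lazard_mon (monalg.mul (monalg.ucm (i, j)) m) =
    lazard_gen i j * lazard_mon m by apply: lazard_monM.
apply: etrans (rmorphM f _ _) _.
apply: etrans _ (esym (rmorphM g _ _)).
by congr (_ * _); [exact: fg | exact: IHm].
Qed.

End LazardMorphisms.

Definition pair_mnm (i j : nat) : 'X_{1..2} :=
  (U_(inord 0) *+ i + U_(inord 1) *+ j)%MM.

Lemma pair_mnmE i j :
  pair_mnm i j (inord 0) = i /\ pair_mnm i j (inord 1) = j.
Proof.
rewrite /pair_mnm !mnmDE !mulmnE !mnm1E !eqxx ord2_neq eq_sym ord2_neq.
by rewrite !mul1n !mul0n addn0.
Qed.

Lemma pair_mnmK (m : 'X_{1..2}) : pair_mnm (m (inord 0)) (m (inord 1)) = m.
Proof.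
have [m0 m1] := pair_mnmE (m (inord 0)) (m (inord 1)).
by apply/mnmP => j; have [->|->] := ord2E j.
Qed.

Lemma lazard_seriesE i j : lazard_series (pair_mnm i.+1 j.+1) = lazard_gen i j.
Proof.
have [m0 m1] := pair_mnmE i.+1 j.+1; move: (pair_mnm _ _) m0 m1 => m m0 m1.
rewrite !fps_coefD /= m0 m1 /=.
have -> : (m == U_(inord 0))%MM = false.
  by apply/eqP => Em; move: m1; rewrite Em mnm1E ord2_neq.
have -> : (m == U_(inord 1))%MM = false.
  by apply/eqP => Em; move: m0; rewrite Em mnm1E eq_sym ord2_neq.
by rewrite !add0r.
Qed.

(** * The morphism out of the Lazard ring classifying a formal group law *)

Section Classifying.
Variables (R : comNzRingType) (F : fps 2 R).
Hypothesis F_fgl : is_fgl F.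

Definition fgl_eval : {rmorphism lazard_poly -> R} :=
  lazard_eval (fun k => F (pair_mnm k.1.+1 k.2.+1)).

Lemma fgl_eval_series : fps_map fgl_eval lazard_series = F.
Proof.
have phi_gen i j : fgl_eval (lazard_gen i j) = F (pair_mnm i.+1 j.+1).
  exact: lazard_evalU.
move: fgl_eval phi_gen => phi phi_gen; apply: fpsP => m.
have [m0|m0] := posnP (m (inord 0)); last first.
  have [m1|m1] := posnP (m (inord 1)); last first.
    rewrite -(pair_mnmK m) -(prednK m0) -(prednK m1) /fps_map.
    by apply: etrans (phi_gen _ _); congr (phi _); apply: lazard_seriesE.
  rewrite (fgl_coef F_fgl (or_intror m1)) !fps_mapD !fps_map_var !fps_coefD /=.
  by rewrite m1 andbF rmorph0 addr0.
rewrite (fgl_coef F_fgl (or_introl m0)) !fps_mapD !fps_map_var !fps_coefD /=.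
by rewrite m0 rmorph0 addr0.
Qed.

(** Substitution commutes with change of coefficients, so [phi] carries the defects of the universal
    series to those of [F], which vanish by the axioms. *)
Lemma lazard_relation_eq0 (phi : {rmorphism lazard_poly -> R}) r :
  fps_map phi lazard_series = F -> lazard_relation r -> phi r = 0.
Proof.
move=> phiF; case: F_fgl => _ _ F_comm F_assoc.
have mapB n (f g : fps n lazard_poly) :
    fps_map phi (f - g) = fps_map phi f - fps_map phi g.
  by apply: fpsP => m /=; rewrite rmorphB.
have comm0 : fps_map phi lazard_comm_defect = 0.
  rewrite /lazard_comm_defect mapB fps_map2 !fps_map_var phiF.
  by rewrite -!/(var _ _ _) F_comm subrr.
have map_defect (L : fps 2 lazard_poly) (x y z : fps 3 lazard_poly) :
    fps_map phi L = F ->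
    fps_map phi (fps2 L (fps2 L x y) z - fps2 L x (fps2 L y z)) =
    fps2 F (fps2 F (fps_map phi x) (fps_map phi y)) (fps_map phi z) -
    fps2 F (fps_map phi x) (fps2 F (fps_map phi y) (fps_map phi z)).
  move=> LF; have map2 k (g h : fps k lazard_poly) :
      fps_map phi (fps2 L g h) = fps2 F (fps_map phi g) (fps_map phi h).
    by rewrite fps_map2 LF.
  rewrite mapB; congr (_ - _); apply: etrans (map2 _ _ _) _.
    by congr fps2; apply: map2.
  by congr fps2; apply: map2.
have assoc0 : fps_map phi lazard_assoc_defect = 0.
  apply: etrans (map_defect _ _ _ _ phiF) _; rewrite !fps_map_var.
  apply/eqP; rewrite subr_eq0; apply/eqP; exact: F_assoc.
case=> -[m ->].
  exact: etrans (congr1 (fun f : fps 2 R => f m) comm0) (fps_coef0 _ _).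
exact: etrans (congr1 (fun f : fps 3 R => f m) assoc0) (fps_coef0 _ _).
Qed.

Lemma fgl_eval_ideal p q : Omega_pi p = Omega_pi q -> fgl_eval p = fgl_eval q.
Proof.
move=> /eqP; rewrite -Quotient.idealrBE => /boolp.asboolP[s [sG /(congr1 fgl_eval)]].
rewrite rmorphB rmorph_sum big_seq big1 => [/subr0_eq//|d /sG dG].
by rewrite rmorphM (lazard_relation_eq0 fgl_eval_series dG) mulr0.
Qed.

(** The value is computed on a chosen representative; [fgl_eval_ideal] makes it independent of the
    choice. *)
Definition classifying_map (x : Omega_U) : R := fgl_eval (repr x).

Lemma classifying_mapE p : classifying_map (Omega_pi p) = fgl_eval p.
Proof. by apply: fgl_eval_ideal; rewrite /Omega_pi reprK. Qed.

Lemma classifying_map_is_zmod_morphism : zmod_morphism classifying_map.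
Proof.
move=> x y; rewrite -[x]reprK -[y]reprK -rmorphB.
by rewrite !(classifying_mapE (_ : lazard_poly)) rmorphB.
Qed.

Lemma classifying_map_is_monoid_morphism : monoid_morphism classifying_map.
Proof.
split=> [|x y].
  by rewrite -(rmorph1 (\pi_Omega_U)%qT) [LHS]classifying_mapE rmorph1.
rewrite -[x]reprK -[y]reprK -rmorphM.
by rewrite !(classifying_mapE (_ : lazard_poly)) rmorphM.
Qed.

Definition classifying_morphism : {rmorphism Omega_U -> R} :=
  HB.pack classifying_map
    (GRing.isZmodMorphism.Build Omega_U R
       classifying_map classifying_map_is_zmod_morphism)
    (GRing.isMonoidMorphism.Build Omega_U R
       classifying_map classifying_map_is_monoid_morphism).

Lemma classifying_map_fgl : fps_map classifying_map F_U = F.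
Proof.
by rewrite -[RHS]fgl_eval_series; apply: fpsP => m; apply: classifying_mapE.
Qed.

(** The classes of the generators are coefficients of [F_U], so their images are prescribed by
    [F]. *)
Lemma classifying_map_unique (phi : {rmorphism Omega_U -> R}) :
  fps_map phi F_U = F -> phi =1 classifying_map.
Proof.
move=> phiF x; rewrite -[x]reprK [RHS]classifying_mapE.
pose pi : {rmorphism lazard_poly -> Omega_U} := (\pi_Omega_U)%qT.
apply: (@lazard_ext R (phi \o pi) fgl_eval) => i j.
rewrite -lazard_seriesE.
apply: etrans (congr1 (fun f : fps 2 R => f (pair_mnm i.+1 j.+1)) phiF) _.
by rewrite -[in LHS]fgl_eval_series.
Qed.

End Classifying.

(** * The Buchstaber genus *)

Section Coefficients.

Lemma dyadic_half_subproof : (2%:R^-1 : rat) \in dyadic_pred.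
Proof. by apply/boolp.asboolP; exists 1%N; rewrite expr1 divff. Qed.

Definition half_Bc : R_Bc := (Dyadic dyadic_half_subproof)%:MP.

Lemma half_BcP : 2%:R * half_Bc = 1.
Proof.
rewrite -[2%:R](rmorph_nat (@mpolyC 3 dyadic)) -rmorphM.
have -> : 2%:R * Dyadic dyadic_half_subproof = 1; last exact: rmorph1.
by apply: val_inj; rewrite rmorphM rmorph_nat rmorph1 /= divff.
Qed.

(** Checked coefficient by coefficient in the rationals, which contain [dyadic]. *)
Lemma R_Bc_torsion_free d (x : R_Bc) : x *+ d.+1 = 0 -> x = 0.
Proof.
move=> xd; apply/mpolyP => m; rewrite mcoeff0; apply: val_inj.
have := congr1 (fun y : {mpoly dyadic[3]} => val y@_m) xd.
by rewrite mcoeffMn mcoeff0 rmorphMn rmorph0 /= => /eqP;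
   rewrite Num.Theory.mulrn_eq0 /= => /eqP.
Qed.

Lemma R_Bc_homog0 d : R_Bc_homog d 0.
Proof. by move=> m; rewrite msupp0. Qed.

Lemma R_Bc_homogC c : R_Bc_homog 0 (c%:MP : R_Bc).
Proof.
move=> m; rewrite msuppC; case: ifP => // _; rewrite inE => /eqP ->.
by rewrite mnmwgt0.
Qed.

Lemma R_Bc_homogX (i : 'I_3) : R_Bc_homog (- (4 * i.+1)%N%:Z) ('X_i : R_Bc).
Proof. by move=> m; rewrite msuppX inE => /eqP ->; rewrite mnmwgt1. Qed.

Lemma R_Bc_homogN d x : R_Bc_homog d x -> R_Bc_homog d (- x).
Proof. by move=> xd m mx; apply: xd; rewrite -(perm_mem (msuppN x)). Qed.

Lemma R_Bc_homogD d x y :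
  R_Bc_homog d x -> R_Bc_homog d y -> R_Bc_homog d (x + y).
Proof.
by move=> xd yd m /msuppD_le; rewrite mem_cat => /orP[/xd|/yd].
Qed.

Lemma R_Bc_homogM d e x y :
  R_Bc_homog d x -> R_Bc_homog e y -> R_Bc_homog (d + e) (x * y).
Proof.
move=> xd ye m /msuppM_le/allpairsP[[k l] /= [kx ly ->]].
by rewrite (xd k kx) (ye l ly) mnmwgtD -opprD mulnDr PoszD.
Qed.

Local Notation u := (var 1 R_Bc 0).
Local Notation v := (var 1 R_Bc 1).
Local Notation sqrtQ := (fps1 (fps_sqrt Q_Bc)).

Lemma sqrtQ_Bc_coef0 : fps_sqrt Q_Bc 0%MM = 1.
Proof.
by case: (fps_sqrtP half_BcP (bc_poly_coef0 a1 a2 a3 (var_coef0 R_Bc 0 0))).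
Qed.

Lemma H_BcE : (u - v) * H_Bc = u * sqrtQ v - v * sqrtQ u.
Proof.
exact: (@classical_sets.xgetPex _ 0
  (fun h => (u - v) * h = u * sqrtQ v - v * sqrtQ u)
  (ex_intro _ _ (chord_quotient_exists _))).
Qed.

Lemma H_Bc_coef0 : H_Bc 0%MM = 1.
Proof. exact: chord_quotient_coef0 sqrtQ_Bc_coef0 H_BcE. Qed.

Lemma F_Bc_is_fgl : is_fgl F_Bc.
Proof.
pose N := H_Bc ^+ 2 + fps_const a3 * u ^+ 2 * v ^+ 2 * (u + v) ^+ 2.
have N0 : N 0%MM = 1.
  rewrite /N fps_coefD !fps_coef0M H_Bc_coef0 fps_coefD !var_coef0 addr0.
  by rewrite !(mul0r, mulr0) mulr1 addr0.
have [S0 S2] := fps_sqrtP half_BcP N0.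
apply: (chord_law_is_fgl half_BcP H_BcE S2 S0 _ R_Bc_torsion_free).
exact: divrK (fps_unit1 S0) _.
Qed.

Lemma F_Bc_homog : fps_homog R_Bc_homog 2%:Z F_Bc.
Proof.
have G1 : R_Bc_homog 0 1 := @R_Bc_homogC 1.
have Gh : R_Bc_homog 0 half_Bc := @R_Bc_homogC _.
refine (chord_law_homog (G := R_Bc_homog) R_Bc_homog0 G1 R_Bc_homogN R_Bc_homogD
  R_Bc_homogM half_BcP Gh _ _ _ H_Bc_coef0 H_BcE).
- by have := @R_Bc_homogX (inord 0); rewrite inordK.
- by have := @R_Bc_homogX (inord 1); rewrite inordK.
- by have := @R_Bc_homogX (inord 2); rewrite inordK.
Qed.

End Coefficients.

(** The generator of index [(i, j)] goes to the coefficient of [F_Bc] at [u^(i+1) v^(j+1)], of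
    degree [2 - 2(i + j + 2) = -2(i + j + 1)], which is the degree of the generator. Degrees add in
    products. *)
Lemma fgl_eval_homog (m : monalg.cmonom lazard_index) :
  R_Bc_homog (lazard_deg m) (fgl_eval F_Bc (lazard_mon m)).
Proof.
elim/cmonom_ind: m => [|[i j] m IHm].
  by rewrite lazard_deg1 rmorph1; apply: (@R_Bc_homogC 1).
have -> : lazard_mon (monalg.mul (monalg.ucm (i, j)) m) =
    lazard_gen i j * lazard_mon m by apply: lazard_monM.
have -> : fgl_eval F_Bc (lazard_gen i j * lazard_mon m) =
  F_Bc (pair_mnm i.+1 j.+1) * fgl_eval F_Bc (lazard_mon m).
  by apply: etrans (rmorphM _ _ _) _; congr (_ * _); apply: lazard_evalU.
rewrite lazard_degM; apply: R_Bc_homogM IHm.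
have := @F_Bc_homog (pair_mnm i.+1 j.+1); congr (R_Bc_homog _ _).
rewrite lazard_degU /pair_mnm mdegD !mdegMn !mdeg1; lia.
Qed.

Theorem corollary3p2 :
  is_fgl F_Bc /\
  exists Bc : {rmorphism Omega_U -> R_Bc},
    [/\ graded_hom Bc,
        fps_map Bc F_U = F_Bc &
        forall phi : {rmorphism Omega_U -> R_Bc},
          fps_map phi F_U = F_Bc -> phi =1 Bc].
Proof.
split; first exact: F_Bc_is_fgl.
exists (classifying_morphism F_Bc_is_fgl); split.
- move=> d x [p [pd ->]]; rewrite [X in R_Bc_homog _ X](classifying_mapE F_Bc_is_fgl).
  (* The representative [p] is an integer combination of monomials of degree [d], and integers are
     homogeneous of degree 0 in [R_Bc]. *)
  rewrite lazard_polyE big_seq; apply: big_ind => [||m /pd ->].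
  + exact: R_Bc_homog0.
  + by move=> y z; apply: R_Bc_homogD.
  rewrite -[lazard_deg m]add0r; apply: R_Bc_homogM; last exact: fgl_eval_homog.
  by rewrite -(rmorph_int (@mpolyC 3 dyadic)); apply: R_Bc_homogC.
- exact: (classifying_map_fgl F_Bc_is_fgl).
- exact: (classifying_map_unique F_Bc_is_fgl).
Qed.
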